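(* Let $(\mathcal{G},\mu)$ be a discrete measured groupoid and let $\mathcal{S}\vartriangleleft\mathcal{G}$ be a normal Borel subgroupoid. Then there exist a discrete measured groupoid $(\mathcal{Q},\zeta)$ and a Borel homomorphism $\theta\colon\mathcal{G}\to\mathcal{Q}$ (mapping $\mathcal{G}^0$ into $\mathcal{Q}^0$) with $\theta_*\mu=\zeta$ such that: (1) $\ker\theta=\mathcal{S}$, where $\ker\theta=\{\gamma\in\mathcal{G}:\theta(\gamma)\in\mathcal{Q}^0\}$; (2) $\theta$ is class-surjective, i.e. for almost every $x\in\mathcal{G}^0$ the restriction of $\theta$ to $x\mathcal{G}$ is a surjection onto $\theta(x)\mathcal{Q}$; (3) (universal property) whenever $\mathcal{Q}'$ is a discrete Borel groupoid and $\theta'\colon\mathcal{G}\to\mathcal{Q}'$ is a Borel homomorphism with $\mathcal{S}\subset\ker\theta'$, there exists a Borel homomorphism $\tau\colon\mathcal{Q}\to\mathcal{Q}'$ with $\theta'=\tau\circ\theta$.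
   Context: All spaces are standard Borel and, in measured settings, all relations among Borel sets and maps hold up to null sets. A discrete Borel groupoid is a groupoid $\mathcal{G}$ which is a standard Borel space, whose unit space $\mathcal{G}^0$ is a Borel subset, whose range and source maps $r,s\colon\mathcal{G}\to\mathcal{G}^0$, multiplication and inversion are Borel, and such that $x\mathcal{G}:=r^{-1}(x)$ is countable for every $x\in\mathcal{G}^0$; also $\mathcal{G}x:=s^{-1}(x)$. For $A,B\subset\mathcal{G}$, $AB=\{gh: g\in A,h\in B,s(g)=r(h)\}$ and $A^{-1}=\{g^{-1}:g\in A\}$. A discrete measured groupoid $(\mathcal{G},\mu)$ is a discrete Borel groupoid together with a probability measure $\mu$ on $\mathcal{G}^0$ such that the measures $\mu^r_{\mathcal{G}}=\int c^r_x\,d\mu(x)$ and $\mu^s_{\mathcal{G}}=\int c^s_x\,d\mu(x)$ on $\mathcal{G}$ are equivalent, $c^r_x,c^s_x$ being the counting measures on $x\mathcal{G}$, $\mathcal{G}x$. An $r$-section is a subset of $\mathcal{G}$ on which $r$ is injective; for an $r$-section $\phi$ and $x\in r(\phi)$, $x\phi$ denotes the unique element of $\phi$ with range $x$. A Borel subgroupoid of $\mathcal{G}$ is always assumed to have unit space $\mathcal{G}^0$. For a Borel subgroupoid $\mathcal{S}$ and $x\in\mathcal{G}^0$, define the equivalence relation $\sim_{\mathcal{S}}$ on $x\mathcal{G}$ by $g\sim_{\mathcal{S}}h$ iff $h^{-1}g\in\mathcal{S}$. For an $r$-section $\phi$ with $r(\phi)=\mathcal{G}^0$ and $\gamma\in\mathcal{G}$,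 write $\phi^{-1}\gamma\phi=(r(\gamma)\phi)^{-1}\gamma(s(\gamma)\phi)$. $\mathrm{End}_{\mathcal{G}}(\mathcal{S})$ is the set of Borel $r$-sections $\phi$ with $r(\phi)=\mathcal{G}^0$ and $\phi^{-1}\gamma\phi\in\mathcal{S}$ for all $\gamma\in\mathcal{S}$. A family of choice functions for $\mathcal{S}<\mathcal{G}$ is a countable family $(\phi_n)$ of Borel $r$-sections with $r(\phi_n)=\mathcal{G}^0$ such that for almost every $x$ and every $g\in x\mathcal{G}$ there is a unique $n$ with $g\sim_{\mathcal{S}}x\phi_n$. $\mathcal{S}$ is normal, $\mathcal{S}\vartriangleleft\mathcal{G}$, if there is a family of choice functions for $\mathcal{S}<\mathcal{G}$ consisting of elements of $\mathrm{End}_{\mathcal{G}}(\mathcal{S})$. *)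

(* Defs.v *)
From HB Require Import structures.
From mathcomp Require Import all_boot all_order all_algebra.
From mathcomp Require Import all_classical all_reals all_analysis.
Set Implicit Arguments. Unset Strict Implicit. Unset Printing Implicit Defensive.
Import Order.TTheory GRing.Theory Num.Theory.
Local Open Scope classical_set_scope.
Local Open Scope ring_scope.

(* Standard Borel space: Borel isomorphic to a Borel subset of the real line
   (Kuratowski); here: a measurable injection f : T -> R with Borel range and a
   measurable left inverse g : R -> T. *)
Definition standard_borel (R : realType) d (T : measurableType d) : Prop :=
  exists (f : T -> R) (g : R -> T),
    measurable_fun setT f /\ measurable_fun setT g /\
    measurable (range f) /\ (forall x, g (f x) = x).

(* The raw data of a groupoid on a measurable carrier T:
   unit space, range, source, multiplication (meaningful on composable
   pairs (g,h), i.e. s g = r h) and inversion. *)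
Record grpd d (T : measurableType d) := Grpd {
  gunit : set T;
  gr : T -> T;
  gs : T -> T;
  gmul : T -> T -> T;
  ginv : T -> T }.

Section Groupoid.
Context d (T : measurableType d) (G : grpd T).
Local Notation U := (gunit G).
Local Notation r := (gr G).
Local Notation s := (gs G).
Local Notation mul := (gmul G).
Local Notation inv := (ginv G).

Definition groupoid_axioms : Prop :=
  [/\ (forall g, U (r g) /\ U (s g)) /\
        (forall u, U u -> r u = u /\ s u = u),
      (forall g h, s g = r h -> r (mul g h) = r g /\ s (mul g h) = s h),
      (forall g h k, s g = r h -> s h = r k ->
          mul (mul g h) k = mul g (mul h k)),
      (forall g, mul (r g) g = g /\ mul g (s g) = g) &
      (forall g, r (inv g) = s g /\ s (inv g) = r g /\
                 mul g (inv g) = r g /\ mul (inv g) g = s g)].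

Definition discrete_borel_groupoid (R : realType) : Prop :=
  [/\ standard_borel R T,
      groupoid_axioms,
      measurable U,
      measurable_fun setT r /\ measurable_fun setT s &
      [/\ measurable_fun [set p : T * T | s p.1 = r p.2]
                         (fun p => mul p.1 p.2),
          measurable_fun setT inv &
          (forall x, U x -> countable [set g | r g = x])]].

Definition mu_r (R : realType) (mu : probability T R) (A : set T) : \bar R :=
  (\int[mu]_(x in U) counting (A `&` [set g | r g = x]))%E.
Definition mu_s (R : realType) (mu : probability T R) (A : set T) : \bar R :=
  (\int[mu]_(x in U) counting (A `&` [set g | s g = x]))%E.

Definition discrete_measured_groupoid (R : realType) (mu : probability T R)
  : Prop :=
  [/\ discrete_borel_groupoid R,
      mu (~` U) = 0%E &
      (forall A, measurable A -> (mu_r mu A = 0%E <-> mu_s mu A = 0%E))].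

(* null subsets of G (w.r.t. mu^r, equivalently mu^s) *)
Definition Gnull (R : realType) (mu : probability T R) (N : set T) : Prop :=
  exists A, [/\ measurable A, N `<=` A & mu_r mu A = 0%E].

Definition borel_subgroupoid (S : set T) : Prop :=
  [/\ measurable S, U `<=` S,
      (forall g h, S g -> S h -> s g = r h -> S (mul g h)) &
      (forall g, S g -> S (inv g))].

Definition full_r_section (phi : set T) : Prop :=
  [/\ measurable phi, {in phi &, injective r} & r @` phi = U].

Definition simS (S : set T) (g h : T) : Prop := S (mul (inv h) g).

(* End_G(S) (condition holding up to null sets):
   phi^{-1} gamma phi = (r(gamma) phi)^{-1} gamma (s(gamma) phi) in S
   for (almost) every gamma in S. *)
Definition in_End (R : realType) (mu : probability T R) (S phi : set T) : Prop :=
  full_r_section phi /\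
  Gnull mu [set gamma | S gamma /\
     exists h1 h2, [/\ phi h1, phi h2, r h1 = r gamma, r h2 = s gamma &
                       ~ S (mul (inv h1) (mul gamma h2))]].

(* family of choice functions for S < G, consisting of elements of End_G(S) *)
Definition normal_subgroupoid (R : realType) (mu : probability T R) (S : set T)
  : Prop :=
  borel_subgroupoid S /\
  exists F : set (set T),
    [/\ countable F,
        (forall phi, F phi -> in_End mu S phi) &
        {ae mu, forall x, U x -> forall g, r g = x ->
           exists! phi, F phi /\
             exists h, [/\ phi h, r h = x & simS S g h]}].

End Groupoid.

Definition borel_hom d (T : measurableType d) d' (T' : measurableType d')
  (G : grpd T) (H : grpd T') (f : T -> T') : Prop :=
  [/\ measurable_fun setT f,
      (forall u, gunit G u -> gunit H (f u)),
      (forall g, gr H (f g) = f (gr G g) /\ gs H (f g) = f (gs G g)) &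
      (forall g h, gs G g = gr G h -> f (gmul G g h) = gmul H (f g) (f h))].

Definition ker d (T : measurableType d) d' (T' : measurableType d')
  (H : grpd T') (f : T -> T') : set T := [set g | gunit H (f g)].

(* Main.v *)
Require Import Defs.
From HB Require Import structures.
From mathcomp Require Import all_boot all_order all_algebra.
From mathcomp Require Import all_classical all_reals all_analysis.
From mathcomp Require Import measurable_realfun lra.
Set Implicit Arguments. Unset Strict Implicit. Unset Printing Implicit Defensive.
Import Order.TTheory GRing.Theory Num.Theory numFieldNormedType.Exports.
Local Open Scope classical_set_scope.
Local Open Scope ring_scope.

(** The unit space of the quotient is the space of "S-invariant data": the
    sigma-algebra of S-invariant Borel sets of units is generated, modulo null
    sets, by one real function [pi], through which every S-invariant Borel
    function factors almost everywhere. A family of choice functions indexes the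
    cosets of S, and normality makes the index [coset_index] invariant under
    multiplication by S on both sides, so that
    [theta g = (pi (r g), coset_index g)] separates exactly the double cosets of
    S over almost every unit. Range, source, inverse and product of [theta g]
    are then S-biinvariant functions of [g], hence Borel functions of [theta g].
    They satisfy the groupoid axioms exactly over a Borel set of base points
    that lift to good units of G; such a set exists because images of Borel sets
    under Borel maps are measurable for the completed measure. The same
    factorization gives the universal property. *)

(** The obstacle is that [pi] is only given up to null sets, need not separate the S-classes of
    units, and factors functions only almost everywhere, whereas a groupoid and a homomorphism must
    satisfy their laws at every point. Two devices restore exactness. Countably many exceptional
    null sets are absorbed into the complement of one conull set of units invariant under all of G,
    so that products and inverses of good arrows stay good. And the choice maps supply, for each
    index [n], an arrow [p n x] over each good unit [x]; hence an arrow of the quotient lifts over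
    any prescribed good point of the fibre of [pi], and composable pairs lift to composable pairs
    although [pi] may glue unrelated units. A second difficulty is that ranges, sources and fibre
    counts of Borel sets of arrows are not known to be Borel. A null set of arrows is therefore
    described by negligibility of its image in the units. Measurability of Borel images for the
    completed measure makes this description equivalent to the integral one, turns sections into
    Borel maps, and carries quasi-invariance to the quotient. *)

(** * Measurability of Suslin sets and Borel images modulo null sets *)

Section Negligible.
Context d (T : measurableType d) (R : realType) (mu : probability T R).

Lemma negligible_countable_bigcup (I : countType) (F : I -> set T) :
  (forall i, mu.-negligible (F i)) -> mu.-negligible (\bigcup_i F i).
Proof.
move=> F0; apply: (@negligibleS _ _ _ _
    (\bigcup_n if unpickle n is Some i then F i else set0)).
  by move=> x [i _ Fx]; exists (pickle i) => //=; rewrite pickleK.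
apply: negligible_bigcup => n; case: unpickle => [i|]; first exact: F0.
exact: negligible_set0.
Qed.

(** Intersecting measurable supersets of measure within [1 / n.+1] of the infimum attains it. Any
    other measurable superset [B] then cuts off only a null part, since the hull intersected with
    [B] is again a competitor for the infimum. *)
Lemma measurable_hull (Y : set T) : exists H, [/\ measurable H, Y `<=` H &
  forall B, measurable B -> Y `<=` B -> mu.-negligible (H `\` B)].
Proof.
pose S := [set mu B | B in [set B | measurable B /\ Y `<=` B]].
pose m := ereal_inf S.
have m_fin : m \is a fin_num.
  rewrite ge0_fin_numE; last first.
    by apply: le_ereal_inf_tmp => _ [B _ <-]; exact: measure_ge0.
  apply: (@le_lt_trans _ _ (mu setT)).
    by apply: ereal_inf_lbound; exists setT.
  by rewrite probability_setT ltry.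
have /choice[B HB] (n : nat) : exists B, [/\ measurable B, Y `<=` B &
    (mu B < m + n.+1%:R^-1%:E)%E].
  have n0 : 0 < n.+1%:R^-1 :> R by rewrite invr_gt0.
  by have [_ [B [mB YB] <-] lB] := lb_ereal_inf_adherent n0 m_fin; exists B.
have mH : measurable (\bigcap_n B n).
  by apply: bigcapT_measurable => n; have [] := HB n.
exists (\bigcap_n B n); split => //.
  by move=> x Yx n _; have [_ YB _] := HB n; exact: YB.
move=> C mC YC; apply/negligibleP; first exact: measurableD.
have Hm : (mu (\bigcap_n B n) <= m)%E.
  apply/lee_addgt0Pr => e e0.
  have [n ne] : exists n : nat, n.+1%:R^-1 < e.
    by have [n _ /(_ _ (leqnn n))] := near_infty_natSinv_lt (PosNum e0); exists n.
  have [mB YB lB] := HB n.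
  apply: (@le_trans _ _ (mu (B n))).
    by apply: le_measure; rewrite ?inE//; exact: bigcap_inf.
  by apply: (le_trans (ltW lB)); rewrite leeD2l// lee_fin ltW.
have fin B' : measurable B' -> (mu B' < +oo)%E.
  by move=> mB'; rewrite (@le_lt_trans _ _ 1%E) ?ltry// probability_le1.
apply/eqP; rewrite -measure_le0 measureD ?fin//.
rewrite lee_subel_addl ?adde0; last first.
  by rewrite ge0_fin_numE ?measure_ge0 ?fin//; exact: measurableI.
apply: (le_trans Hm); apply: ereal_inf_lbound; exists (\bigcap_n B n `&` C) => //.
split; first exact: measurableI.
by move=> x Yx; split; [move=> n _; have [_ YB _] := HB n; exact: YB|exact: YC].
Qed.

End Negligible.

(** Continuity on Baire space for the discrete topology on [V]. Suslin schemes are indexed by such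
    functions instead of finite sequences, which makes reindexing of coordinates harmless. *)
Definition locally_cst (V : Type) (F : (nat -> nat) -> V) :=
  forall s, exists N : nat, forall t, (forall i, (i < N)%N -> t i = s i) ->
    F t = F s.

Section SuslinNullMeasurable.
Context d (T : measurableType d) (R : realType) (mu : probability T R).

(* Marczewski's argument: replace each A_s by a measurable hull H_s; off a null
   set, a point of H_s lies in some H_(s,k), and one follows a branch. *)
Lemma suslin_null_measurable (F : nat -> (nat -> nat) -> set T) :
  (forall n, locally_cst (F n)) -> (forall n s, measurable (F n s)) ->
  let A := [set x | exists s, forall n, F n s x] in
  exists B, [/\ measurable B, B `<=` A & mu.-negligible (A `\` B)].
Proof.
move=> Flc mF A.
pose cyl (l : seq nat) : set (nat -> nat) :=
  [set s | forall i, (i < size l)%N -> s i = nth 0%N l i].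
pose As l := [set x | exists2 s, cyl l s & forall n, F n s x].
have /choice[H0 H0P] := fun l => measurable_hull mu (As l).
(* [C l] collects the constraints already decided by the prefix [l], evaluated at [l] padded with
   zeros. Cutting the hull by it forces a point that follows a branch into each [F n] at some finite
   stage. *)
pose C l := \bigcap_n
  (if `[< forall s, cyl l s -> F n s = F n (nth 0%N l) >]
   then F n (nth 0%N l) else setT).
have mC l : measurable (C l).
  by apply: bigcapT_measurable => n; case: ifP.
have AsC l : As l `<=` C l.
  move=> x [s ls Fx] n _; case: ifPn => // /asboolP h.
  by rewrite -(h s ls).
pose H l := H0 l `&` C l.
have mH l : measurable (H l).
  by apply: measurableI => //; have [] := H0P l.
have AsH l : As l `<=` H l.
  by move=> x Ax; split; [have [_ h _] := H0P l; exact: h|exact: AsC].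
pose N l := H l `\` \bigcup_k H (rcons l k).
have N0 l : mu.-negligible (N l).
  have [_ _ /(_ (\bigcup_k H (rcons l k)))] := H0P l.
  have m1 : measurable (\bigcup_k H (rcons l k)) by apply: bigcupT_measurable.
  have s1 : As l `<=` \bigcup_k H (rcons l k).
    move=> x [s ls Fx]; exists (s (size l)) => //; apply: AsH; exists s => //.
    move=> i; rewrite size_rcons ltnS leq_eqVlt => /orP[/eqP ->|il].
      by rewrite nth_rcons ltnn eqxx.
    by rewrite nth_rcons il; exact: ls.
  move=> /(_ m1 s1); apply: negligibleS.
  by move=> x [[Hx _] nx]; split.
have [M [mM M0 NM]] := negligible_countable_bigcup N0.
exists (H [::] `\` M); split; first exact: measurableD.
  move=> x [Hx Mx].
  have Hstep l : exists k, H l x -> H (rcons l k) x.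
    have [Hlx|] := pselect (H l x); last by exists 0%N.
    apply: contrapT => nk; apply: Mx; apply: NM; exists l => //; split=> //.
    by move=> [k _ Hk]; apply: nk; exists k.
  have [K HK] := choice Hstep.
  pose L n := iter n (fun l => rcons l (K l)) [::].
  have HL n : H (L n) x by elim: n => //= n; exact: HK.
  have sL n : size (L n) = n by elim: n => //= n ih; rewrite size_rcons ih.
  pose s n := K (L n).
  have nthL n i : (i < n)%N -> nth 0%N (L n) i = s i.
    elim: n => //= n ih; rewrite ltnS leq_eqVlt nth_rcons sL.
    by move=> /orP[/eqP ->|il]; rewrite ?ltnn ?eqxx// il ih.
  exists s => n; have [m hm] := Flc n s.
  have [_ /(_ n I)] := HL m; rewrite (hm (nth 0%N (L m))); last exact: nthL.
  case: ifPn => // /asboolPn[] t tL; apply: hm => i im.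
  by rewrite tL ?sL// nthL.
exists M; split=> // x [[s Fx] nB]; apply: contrapT => nM; apply: nB.
by split=> //; apply: AsH; exists s.
Qed.

End SuslinNullMeasurable.

Section SuslinRelation.
Context d (X : measurableType d).
Local Notation W := (X * (nat -> nat))%type.

(** A Suslin scheme with a parameter [c] besides the witness [s]. Since both range over Baire space,
    projecting [c] away yields an ordinary Suslin set. *)
Definition suslin_rel (D : set W) :=
  exists F : nat -> (nat -> nat) -> (nat -> nat) -> set X,
  [/\ forall n c s, exists N : nat, forall c' s',
        (forall i, (i < N)%N -> c' i = c i /\ s' i = s i) -> F n c' s' = F n c s,
      forall n c s, measurable (F n c s) &
      forall x c, D (x, c) <-> exists s, forall n, F n c s x].

(** A single witness stores one witness for each [k], at the coordinates [pickle (k, m)]. *)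
Lemma suslin_rel_bigcap (D : (set W)^nat) :
  (forall k, suslin_rel (D k)) -> suslin_rel (\bigcap_k D k).
Proof.
move=> /choice[F HF].
exists (fun n c s => if unpickle n is Some (k, j)
  then F k j c (fun m => s (pickle (k, m))) else setT); split.
- move=> n c s; case: unpickle => [[k j]|]; last by exists 0%N.
  have [+ _ _] := HF k => /(_ j c (fun m => s (pickle (k, m))))[N hN].
  (* Agreement below [M] forces agreement of the [k]-th subsequence below [N], because the sum
     exceeds every code [pickle (k, m)] with [m < N]. *)
  pose M := (N + \sum_(m < N) (pickle (k, nat_of_ord m)).+1)%N.
  exists M => c' s' ag; apply: hN => i iN; split.
    by case: (ag i) => //; rewrite /M ltn_addr.
  case: (ag (pickle (k, i))) => //.
  by rewrite /M (bigD1 (Ordinal iN)) //= addnCA addSn ltnS leq_addr.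
- move=> n c s; case: unpickle => [[k j]|]; last exact: measurableT.
  by have [_ + _] := HF k.
- move=> x c; split.
    move=> Dx; have /choice[s Hs] (k : nat) :
        exists s : nat -> nat, forall n, F k n c s x.
      by have [_ _ h] := HF k; apply/h; exact: Dx.
    exists (fun n => if unpickle n is Some (k, j) then s k j else 0%N) => n.
    case: unpickle => [[k j]|] //.
    under [X in F k j c X]funext do rewrite pickleK.
    exact: Hs.
  move=> [s Hs] k _; have [_ _ h] := HF k; apply/h.
  exists (fun m => s (pickle (k, m))) => j.
  by have := Hs (pickle (k, j)); rewrite pickleK.
Qed.

(** Coordinate 0 of the witness names the member of the union, and the remaining coordinates witness
    membership in it. *)
Lemma suslin_rel_bigcup (D : (set W)^nat) :
  (forall k, suslin_rel (D k)) -> suslin_rel (\bigcup_k D k).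
Proof.
move=> /choice[F HF].
exists (fun n c s => F (s 0%N) n c (fun m => s m.+1)); split.
- move=> n c s; have [+ _ _] := HF (s 0%N).
  move=> /(_ n c (fun m => s m.+1))[N hN]; exists N.+1 => c' s' ag.
  have [_ ->] := ag 0%N isT; apply: hN => i iN; split.
    by have [] := ag i (ltnW iN).
  by have [] := ag i.+1 iN.
- by move=> n c s; have [_ + _] := HF (s 0%N).
- move=> x c; split.
    move=> [k _ Dk]; have [_ _ h] := HF k; have [s Hs] := (h x c).1 Dk.
    by exists (fun n => if n is m.+1 then s m else k) => n /=; exact: Hs.
  move=> [s Hs]; exists (s 0%N) => //; have [_ _ h] := HF (s 0%N); apply/h.
  by exists (fun m => s m.+1).
Qed.

Lemma suslin_rel_clopen (F : (nat -> nat) -> set X) :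
  locally_cst F -> (forall c, measurable (F c)) ->
  suslin_rel [set p | F p.2 p.1].
Proof.
move=> Flc mF; exists (fun _ c _ => F c); split => //.
- move=> _ c s; have [N hN] := Flc c; exists N => c' s' ag; apply: hN => i iN.
  by have [] := ag i iN.
- by move=> x c; split=> [Fx|[_ /(_ 0%N)]]; first exists (fun=> 0%N).
Qed.

Definition seq_cylinders : set (set W) :=
  [set D | (exists2 E, measurable E & D = fst @^-1` E) \/
           (exists k j, D = [set p | p.2 k = j])].

Local Notation WT := (g_sigma_algebraType seq_cylinders).

(** Suslin sets are not closed under complement, so the induction runs over the sets that are Suslin
    together with their complement; these form a sigma-algebra containing the cylinders. *)
Lemma measurable_suslin_rel (D : set WT) : measurable D -> suslin_rel D.
Proof.
pose K := [set D : set W | suslin_rel D /\ suslin_rel (~` D)].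
have sK : sigma_algebra setT K.
  split.
  - have h (b : bool) : suslin_rel [set p : W | b].
      by apply: (@suslin_rel_clopen (fun _ => [set x : X | b]));
        [move=> s; exists 0%N|case: b => c; rewrite ?set_true ?set_false].
    split; [have := h false|have := h true].
      by rewrite set_false.
    by rewrite set_true setC0.
  - by move=> A [A1 A2]; rewrite setTD; split; rewrite ?setCK.
  - move=> F HF; split.
      by apply: suslin_rel_bigcup => k; have [] := HF k.
    by rewrite setC_bigcup; apply: suslin_rel_bigcap => k; have [] := HF k.
have : <<s seq_cylinders >> `<=` K.
  apply: smallest_sub => // A [[E mE ->]|[k [j ->]]].
    have h B : measurable B -> suslin_rel (fst @^-1` B).
      by move=> mB; apply: (@suslin_rel_clopen (fun=> B)) => // s; exists 0%N.
    by split; [exact: h|rewrite preimage_setC; apply: h; exact: measurableC].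
  have mP (P : Prop) : measurable [set _ : X | P].
    by have [p|p] := pselect P; [rewrite (_ : mkset _ = setT)|
      rewrite (_ : mkset _ = set0)]; rewrite //; apply/seteqP; split.
  by split; [apply: (@suslin_rel_clopen (fun c => [set x : X | c k = j]))|
    apply: (@suslin_rel_clopen (fun c => [set x : X | c k <> j]))] => // s;
    exists k.+1 => t ->.
by move=> h /h[].
Qed.

Lemma measurable_fun_fst_seq : measurable_fun setT (fst : WT -> X).
Proof.
move=> _ E mE; rewrite setTI; apply: sub_gen_smallest; left.
by exists E.
Qed.

Lemma measurable_fun_snd_seq k :
  measurable_fun setT ((fun p => p.2 k) : WT -> nat).
Proof.
move=> _ B _; rewrite setTI.
rewrite (_ : _ @^-1` _ = \bigcup_(j in B) [set p : WT | p.2 k = j]).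
  apply: bigcup_measurable => j _; apply: sub_gen_smallest; right.
  by exists k, j.
by apply/seteqP; split=> [p Bp|p [j Bj /= pj]]; [exists (p.2 k)|rewrite /= pj].
Qed.

(** Parameter and witness are interleaved into one sequence, on the even and the odd coordinates. *)
Lemma suslin_rel_proj_null_measurable (R : realType) (mu : probability X R)
    (D : set W) : suslin_rel D ->
  exists B, [/\ measurable B, B `<=` [set x | exists c, D (x, c)] &
    mu.-negligible ([set x | exists c, D (x, c)] `\` B)].
Proof.
move=> [F [Flc mF FD]].
pose G n s := F n (fun i => s i.*2) (fun i => s i.*2.+1).
have Glc n : locally_cst (G n).
  move=> s; have [N hN] := Flc n (fun i => s i.*2) (fun i => s i.*2.+1).
  exists (N.*2) => t ag; apply: hN => i iN.
  by rewrite !ag ?ltn_double// -doubleS leq_double.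
have := suslin_null_measurable mu Glc (fun n s => mF n _ _).
suff -> : [set x | exists s, forall n, G n s x] = [set x | exists c, D (x, c)].
  by [].
apply/seteqP; split=> [x [s Hs]|x [c /FD[s Hs]]].
  by exists (fun i => s i.*2); apply/FD; exists (fun i => s i.*2.+1).
exists (fun i => if odd i then s i./2 else c i./2) => n.
rewrite /G; under [X in F n X]funext do rewrite odd_double doubleK.
under [X in F n _ X]funext do rewrite /= odd_double/= uphalf_double.
exact: Hs.
Qed.

End SuslinRelation.

Section AnalyticNullMeasurable.
Context (R : realType).

(** A measurable surjection of Baire space onto the line: [c] codes a sequence of rationals. The
    upper limit exists for every sequence, so no set of convergent sequences has to be singled out;
    [fine] sends infinite values to 0. *)
Definition seq_real (c : nat -> nat) : R :=
  fine (limn_esup (fun n => (ratr (odflt 0 (unpickle (c n))) : R)%:E)).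

Lemma seq_real_surj y : exists c, seq_real c = y.
Proof.
have /choice[q Hq] (n : nat) :
    exists q : rat, y < ratr q < y + n.+1%:R^-1.
  have : y < y + n.+1%:R^-1 by rewrite ltrDl invr_gt0.
  move=> /rat_in_itvoo[q]; rewrite in_itv/= => h; by exists q.
exists (fun n => pickle (q n)); rewrite /seq_real.
under [X in limn_esup X]funext do rewrite pickleK/=.
have qy : (fun n => (ratr (q n))%:E : \bar R) @ \oo --> y%:E.
  apply: cvg_EFin; first by apply: nearW.
  apply: (@squeeze_cvgr _ _ _ _ (fun=> y) (fun n => y + n.+1%:R^-1)).
  - by apply: nearW => n; have /andP[h1 h2] := Hq n; rewrite !ltW.
  - exact: cvg_cst.
  - rewrite -[X in _ --> X]addr0; apply: cvgD; first exact: cvg_cst.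
    exact: cvg_harmonic.
by rewrite is_cvg_limn_esupE; [rewrite (cvg_lim _ qy)|apply/cvg_ex; exists y%:E].
Qed.

Lemma measurable_fun_seq_real d (X : measurableType d) :
  measurable_fun setT
    ((fun p => seq_real p.2) : g_sigma_algebraType (@seq_cylinders _ X) -> R).
Proof.
apply: (measurableT_comp (fine_measurable measurableT)).
apply: measurable_fun_limn_esup => n.
have mq : measurable_fun setT
    (fun j : nat => (ratr (odflt 0 (unpickle j)) : R)%:E) by [].
exact: measurableT_comp mq (@measurable_fun_snd_seq _ X n).
Qed.

(** With [T] parametrized by Baire space through [h], the image is the projection of the set of
    pairs [(x, c)] with [h] in [A] and [x] equal to [f] of it. That equation is tested in the line,
    through [j], where equality is measurable. *)
Lemma image_null_measurable d (T : measurableType d) d' (X : measurableType d')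
    (mu : probability X R) (f : T -> X) (A : set T) :
  standard_borel R T -> standard_borel R X ->
  measurable_fun setT f -> measurable A ->
  exists B, [/\ measurable B, B `<=` f @` A & mu.-negligible (f @` A `\` B)].
Proof.
move=> [i [g [mi [mg [_ gi]]]]] [j [jv [mj [_ [_ jK]]]]] mf mA.
pose WT := g_sigma_algebraType (@seq_cylinders _ X).
pose h (p : WT) : T := g (seq_real p.2).
have mh : measurable_fun setT h.
  exact: measurableT_comp mg (@measurable_fun_seq_real _ X).
pose D : set WT := (h @^-1` A) `&` [set p | j p.1 == j (f (h p))].
have mD : measurable D.
  apply: measurableI; first by rewrite -[X in measurable X]setTI; exact: mh.
  have : measurable_fun setT (fun p : WT => j p.1 == j (f (h p))).
    apply: measurable_fun_eqr.
      exact: measurableT_comp mj (@measurable_fun_fst_seq _ X).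
    by apply: measurableT_comp => //; exact: measurableT_comp.
  by move=> /(_ measurableT [set true] I); rewrite setTI.
have := suslin_rel_proj_null_measurable mu (measurable_suslin_rel mD).
suff -> : [set x | exists c, D (x, c)] = f @` A by [].
apply/seteqP; split=> [x [c [/= Ah /eqP jx]]|x [t At <-]].
  exists (g (seq_real c)) => //.
  by rewrite -[LHS]jK -[RHS]jK jx.
have [c ci] := seq_real_surj (i t); exists c.
by split; rewrite /= /h /= ci gi.
Qed.

End AnalyticNullMeasurable.

(** * Null sets of a discrete measured groupoid *)

Section LowerIntegral.
Context d (T : measurableType d) (R : realType) (mu : probability T R).
Local Open Scope ereal_scope.

(* The integral of a nonnegative function is defined as a supremum over simple
   functions below it, so it is monotone without any measurability. *)
Lemma ge0_le_lower_integral (D : set T) (f g : T -> \bar R) :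
  (forall x, 0 <= f x) -> (forall x, f x <= g x) ->
  \int[mu]_(x in D) f x <= \int[mu]_(x in D) g x.
Proof.
move=> f0 fg; have g0 x : 0 <= g x by exact: le_trans (fg x).
rewrite !ge0_integralE//; apply: le_ereal_sup => _ [h /= hf <-].
exists h => //= x; apply: (le_trans (hf x)).
by rewrite /patch; case: ifP.
Qed.

(** The fibre count is not known to be measurable in [x], so the integral is only compared: from
    below with the indicator of a Borel set filling the image of [A] up to a null set, from above
    with [+oo] on a null set containing that image. *)
Lemma integral_counting_fiber_eq0 (D A : set T) (f : T -> T) :
  standard_borel R T -> measurable D -> measurable_fun setT f ->
  (forall g, D (f g)) -> measurable A ->
  \int[mu]_(x in D) counting (A `&` [set g | f g = x]) = 0 <->
  mu.-negligible (f @` A).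
Proof.
move=> sT mD mf Df mA.
have counting_ge0 (Y : set T) : 0 <= counting Y :> \bar R.
  by rewrite /counting; case: ifP => // _; rewrite lee_fin.
split=> [int0|[N [mN N0 fAN]]].
  have [B [mB BfA fAB]] := image_null_measurable mu sT sT mf mA.
  suff muB : mu B = 0.
    apply: (@negligibleS _ _ _ _ ((f @` A `\` B) `|` B)).
      by move=> x fx; have [Bx|nBx] := pselect (B x); [right|left].
    by apply: negligibleU => //; apply/negligibleP.
  apply/eqP; rewrite -measure_le0 -int0.
  have iB : \int[mu]_(x in D) (\1_B x)%:E = mu B.
    rewrite integral_indic// setIidl// => x /BfA[t _ <-]; exact: Df.
  apply: (@le_trans _ _ (\int[mu]_(x in D) (\1_B x)%:E)); first by rewrite iB.
  apply: ge0_le_lower_integral => x; first by rewrite lee_fin.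
  rewrite indicE; case: (boolP (x \in B)) => [/set_mem Bx|_]; last exact: counting_ge0.
  have [t At tx] := BfA x Bx.
  rewrite /counting; case: ifPn => [/asboolP fin|_]; last exact: leey.
  rewrite lee_fin ler1n finmap.cardfs_gt0; apply/finmap.fset0Pn; exists t.
  by rewrite in_fset_set// inE.
apply/eqP; rewrite eq_le; apply/andP; split; last first.
  by apply: integral_ge0 => x _; exact: counting_ge0.
apply: (@le_trans _ _ (\int[mu]_(x in D) ((cst +oo) \_ N) x)).
  apply: ge0_le_lower_integral => x; first exact: counting_ge0.
  rewrite /patch; case: ifPn => [_|]; first exact: leey.
  rewrite notin_setE => Nx.
  have -> : A `&` [set g | f g = x] = set0.
    by apply/seteqP; split=> // t [At /= fx]; apply: Nx; apply: fAN; exists t.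
  by rewrite /counting; case: ifPn => [_|/asboolPn[]//]; rewrite fset_set0.
have DN0 : mu.-negligible (D `&` N) by exists N; split=> //; exact: subIsetr.
rewrite -integral_mkcondr integral_cst ?measure_negligible ?mule0//;
  exact: measurableI.
Qed.

End LowerIntegral.

Section GroupoidNull.
Context d (T : measurableType d) (R : realType) (G : grpd T)
  (mu : probability T R).
Local Notation U := (gunit G).
Local Notation r := (gr G).
Local Notation s := (gs G).
Hypothesis dG : discrete_borel_groupoid G R.

Lemma mu_r_eq0 A : measurable A ->
  mu_r G mu A = 0%E <-> mu.-negligible (r @` A).
Proof.
move=> mA; have [sT [[H _] _ _ _ _] mU [mr _] _] := dG.
by apply: integral_counting_fiber_eq0 => // g; have [] := H g.
Qed.

Lemma mu_s_eq0 A : measurable A ->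
  mu_s G mu A = 0%E <-> mu.-negligible (s @` A).
Proof.
move=> mA; have [sT [[H _] _ _ _ _] mU [_ ms] _] := dG.
by apply: integral_counting_fiber_eq0 => // g; have [] := H g.
Qed.

(** A null set of arrows may be enlarged to the full preimage under [r] of a null set of units,
    which moves almost-everywhere statements about arrows to the unit space. *)
Lemma GnullP N : Gnull G mu N <-> mu.-negligible (r @` N).
Proof.
split=> [[A [mA NA /(mu_r_eq0 mA)]]|[M [mM M0 rNM]]].
  by apply: negligibleS; exact: image_subset.
have [_ _ _ [mr _] _] := dG.
have mA : measurable (r @^-1` M) by rewrite -[X in measurable X]setTI; exact: mr.
exists (r @^-1` M); split=> //; first by move=> g Ng; apply: rNM; exists g.
by apply/mu_r_eq0 => //; exists M; split=> // _ [g Mg <-].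
Qed.

End GroupoidNull.

Section InvariantSets.
Context d (T : measurableType d) (R : realType) (G : grpd T)
  (mu : probability T R).
Local Notation U := (gunit G).
Local Notation r := (gr G).
Local Notation s := (gs G).
Hypothesis dG : discrete_measured_groupoid G mu.

Definition invariant_conull (X : set T) :=
  [/\ measurable X, X `<=` U, mu (~` X) = 0%E & forall g, X (r g) <-> X (s g)].

(** By quasi-invariance the sources of the arrows with range in a null set lie in a null set again.
    Iterating and taking the union gives a null set closed from range to source, and inverses give
    the other direction. *)
Lemma invariant_conull_sub (N : set T) : mu.-negligible N ->
  exists X, invariant_conull X /\ X `<=` ~` N.
Proof.
have [bG muU qi] := dG.
have [sT [[H1 _] _ _ _ H2] mU [mr ms] _] := bG.
have step (M : set T) : measurable M -> mu M = 0%E ->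
    exists M', [/\ measurable M', mu M' = 0%E & s @` (r @^-1` M) `<=` M'].
  move=> mM M0.
  have mA : measurable (r @^-1` M) by rewrite -[X in measurable X]setTI; exact: mr.
  have : mu_r G mu (r @^-1` M) = 0%E.
    by apply/mu_r_eq0 => //; exists M; split=> // _ [g Mg <-].
  by move=> /(qi _ mA)/(mu_s_eq0 _ bG mA)[M' [? ? ?]]; exists M'.
move=> [N0 [mN0 N00 NN0]].
have /choice[K HK] (M : set T) : exists M', measurable M -> mu M = 0%E ->
    [/\ measurable M', mu M' = 0%E & s @` (r @^-1` M) `<=` M'].
  have [[mM M0]|h] := pselect (measurable M /\ mu M = 0%E).
    by have [M' ?] := step M mM M0; exists M'.
  by exists set0 => mM M0; exfalso; apply: h.
pose M n := iter n K (N0 `|` ~` U).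
have HM n : measurable (M n) /\ mu (M n) = 0%E.
  elim: n => [|n [ih1 ih2]]; last by have [] := HK _ ih1 ih2.
  split; first by apply: measurableU => //; exact: measurableC.
  apply: measure_negligible; first by apply: measurableU => //; exact: measurableC.
  by apply: negligibleU; apply/negligibleP => //; exact: measurableC.
have MS n g : M n (r g) -> M n.+1 (s g).
  by move=> Mg; have [h1 h2] := HM n; have [_ _] := HK _ h1 h2; apply; exists g.
have mM : measurable (\bigcup_n M n).
  by apply: bigcupT_measurable => n; have [] := HM n.
exists (~` \bigcup_n M n); split; last first.
  by move=> x nM /NN0 Nx; apply: nM; exists 0%N => //; left.
split.
- exact: measurableC.
- by move=> x nM; apply: contrapT => nU; apply: nM; exists 0%N => //; right.
- rewrite setCK; apply: measure_negligible => //; apply: negligible_bigcup => n.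
  by have [h1 h2] := HM n; apply/negligibleP.
- move=> g; split=> nM [n _ Mn]; apply: nM; exists n.+1 => //; last exact: MS.
  have [rs [sr _]] := H2 g; rewrite -sr; apply: MS; by rewrite rs.
Qed.

Lemma invariant_conullI X Y : invariant_conull X -> invariant_conull Y ->
  invariant_conull (X `&` Y).
Proof.
move=> [mX XU X0 iX] [mY YU Y0 iY]; split.
- exact: measurableI.
- by move=> x [/XU].
- rewrite setCI; apply: measure_negligible.
    by apply: measurableU; exact: measurableC.
  by apply: negligibleU; apply/negligibleP => //; exact: measurableC.
- by move=> g; split=> -[/iX ? /iY].
Qed.

End InvariantSets.

(** * Measurable choice and factorization modulo null sets *)

Section AeFactor.
Context d (X : measurableType d) d' (Y : measurableType d') (R : realType).
Variables (mu : probability X R) (p : X -> Y).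

(** [h x] is the supremum of the rationals below it, so [F y] is taken as the supremum of the
    rationals whose set [B n] contains [y]. The two agree off the countable union of the exceptional
    sets. *)
Lemma ae_factor_real (h : X -> R) :
  (forall q : rat, exists2 B, measurable B &
     mu.-negligible [set x | ~ (ratr q < h x <-> B (p x))]) ->
  exists2 F : Y -> R, measurable_fun setT F &
    mu.-negligible [set x | h x <> F (p x)].
Proof.
move=> H; have /choice[B HB] (n : nat) : exists B, measurable B /\
    mu.-negligible [set x |
      ~ (ratr (odflt 0 (unpickle n : option rat)) < h x <-> B (p x))].
  by have [B] := H (odflt 0 (unpickle n)); exists B.
pose q n : R := ratr (odflt 0 (unpickle n : option rat)).
pose f n y : \bar R := if y \in B n then (q n)%:E else -oo%E.
exists (fun y => fine (esups (f^~ y) 0%N)).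
  apply: (measurableT_comp (fine_measurable measurableT)).
  apply: measurable_fun_esups => n; apply: measurable_fun_ifT => //.
  apply: (measurable_fun_bool true); rewrite setTI.
  have [mB _] := HB n; rewrite (_ : _ @^-1` _ = B n)//.
  by apply/seteqP; split=> y /=; [exact: set_mem|exact: mem_set].
apply: (@negligibleS _ _ _ _
    (\bigcup_n [set x | ~ (q n < h x <-> B n (p x))])).
  move=> x /= hx; apply: contrapT => nb; apply: hx.
  have hB n : q n < h x <-> B n (p x).
    by apply: contrapT => nn; apply: nb; exists n.
  suff -> : esups (f^~ (p x)) 0%N = (h x)%:E by [].
  apply/eqP; rewrite eq_le; apply/andP; split.
    apply: ge_ereal_sup => _ [n _ <-]; rewrite /f; case: ifPn => [|_].
      by rewrite inE => /hB/ltW; rewrite lee_fin.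
    exact: leNye.
  have up (r : rat) : ratr r < h x -> ((ratr r : R)%:E <= esups (f^~ (p x)) 0%N)%E.
    move=> rh; apply: ereal_sup_ubound; exists (pickle r) => //.
    have qr : q (pickle r) = ratr r by rewrite /q pickleK.
    by rewrite /f qr ifT// inE; apply/hB; rewrite qr.
  apply/lee_subgt0Pr => e e0.
  have [r] : exists r : rat, ratr r \in `](h x - e), (h x)[%R.
    by have [|r] := @rat_in_itvoo R (h x - e) (h x); [rewrite ltrBlDr ltrDl|exists r].
  rewrite in_itv /= => /andP[r1 r2]; apply: le_trans (up r r2).
  by rewrite -EFinB lee_fin ltW.
by apply: negligible_bigcup => n; have [] := HB n.
Qed.

Lemma ae_factor d'' (Z : measurableType d'') (h : X -> Z) :
  standard_borel R Z ->
  (forall C, measurable C -> exists2 B, measurable B &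
     mu.-negligible [set x | ~ (C (h x) <-> B (p x))]) ->
  exists2 F : Y -> Z, measurable_fun setT F &
    mu.-negligible [set x | h x <> F (p x)].
Proof.
move=> [i [g [mi [mg [_ gi]]]]] H.
have [|F mF F0] := @ae_factor_real (i \o h).
  move=> q; have [|B mB B0] := H (i @^-1` `]ratr q, +oo[%classic).
    by rewrite -[X in measurable X]setTI; exact: mi.
  exists B => //; apply: negligibleS B0 => x /=.
  by rewrite in_itv/= andbT.
exists (g \o F); first exact: measurableT_comp.
by apply: negligibleS F0 => x /= hg hF; apply: hg; rewrite -hF gi.
Qed.

End AeFactor.

Section Sections.
Context d (T : measurableType d) (R : realType) (G : grpd T)
  (mu : probability T R).
Hypothesis dG : discrete_measured_groupoid G mu.

(** The preimage of [C] under the selection from [phi] is the range of [phi] intersected with [C],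
    which is Borel up to a null set. Almost-everywhere factorization through the identity then
    replaces the selection by a Borel map. *)
Lemma full_r_section_measurable_choice (phi : set T) : full_r_section G phi ->
  exists2 p : T -> T, measurable_fun setT p &
    mu.-negligible [set x | ~ (phi (p x) /\ gr G (p x) = x)].
Proof.
have [[sT _ mU [mr _] _] muU _] := dG; move=> [mphi inj img].
have /choice[h Hh] (x : T) : exists g, gunit G x -> phi g /\ gr G g = x.
  have [Ux|] := pselect (gunit G x); last by exists x.
  by move: (Ux); rewrite -img => -[g pg gx]; exists g.
have U0 : mu.-negligible (~` gunit G).
  by apply/negligibleP => //; exact: measurableC.
have [|p mp p0] := @ae_factor _ T _ T R mu id _ T h sT.
  move=> C mC; have mphiC : measurable (phi `&` C) by exact: measurableI.
  have [B [mB Bsub B0]] := image_null_measurable mu sT sT mr mphiC.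
  exists B => //; apply: negligibleS (negligibleU B0 U0) => x nx.
  have [Ux|] := pselect (gunit G x); [left|by right].
  have [ph rh] := Hh x Ux.
  have hC : C (h x) <-> (gr G @` (phi `&` C)) x.
    split=> [Ch|[g [pg Cg] gx]]; first by exists (h x).
    suff <- : g = h x by [].
    by apply: inj; rewrite ?inE// gx rh.
  split; last by move=> Bx; apply: nx; split=> // _; apply/hC; exact: Bsub.
  by apply/hC; apply: contrapT => nC; apply: nx; split=> // /Bsub/hC.
exists p => //; apply: negligibleS (negligibleU p0 U0) => x /= nx.
have [Ux|] := pselect (gunit G x); [left|by right].
by move=> hp; apply: nx; rewrite -hp; exact: Hh.
Qed.

End Sections.

(** * Generating sub-sigma-algebras by one function *)

Section TernaryCode.
Context (R : realType).

(** Partial sums of the Cantor coding, with ternary digits 0 and 2. Unlike binary expansions it is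
    injective, with a gap that makes decoding Borel. *)
Definition ternary_partial (c : nat -> bool) (n : nat) : R :=
  \sum_(0 <= k < n) (c k)%:R * 2 / 3 ^+ k.+1.

Lemma ternary_partialS c n : ternary_partial c n.+1 =
  (c 0%N)%:R * 2 / 3 + ternary_partial (fun k => c k.+1) n / 3.
Proof.
rewrite /ternary_partial big_nat_recl// expr1 mulr_suml; congr (_ + _).
by apply: eq_bigr => k _; rewrite [in LHS]exprSr invfM mulrA.
Qed.

Lemma ternary_partial_le1 c n : ternary_partial c n <= 1.
Proof.
elim: n c => [|n ih] c; first by rewrite /ternary_partial big_geq.
rewrite ternary_partialS; have := ih (fun k => c k.+1).
by case: (c 0%N) => /=; lra.
Qed.

Lemma ternary_partial_nd c :
  {homo ternary_partial c : n m / (n <= m)%N >-> n <= m}.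
Proof.
by move=> n m nm; rewrite /ternary_partial (big_cat_nat (leq0n n) nm)//= lerDl sumr_ge0//.
Qed.

Definition ternary (c : nat -> bool) : R := limn (ternary_partial c).

Lemma ternary_cvg c : ternary_partial c @ \oo --> ternary c.
Proof.
apply: nondecreasing_is_cvgn; first exact: ternary_partial_nd.
by exists 1 => _ [n _ <-]; exact: ternary_partial_le1.
Qed.

Lemma ternary01 c : 0 <= ternary c <= 1.
Proof.
have cv : cvgn (ternary_partial c) by apply/cvg_ex; exists (ternary c); exact: ternary_cvg.
apply/andP; split; last by apply: limr_le => //; apply: nearW => n; exact: ternary_partial_le1.
apply: limr_ge => //; apply: nearW => n.
have -> : 0 = ternary_partial c 0 by rewrite /ternary_partial big_geq.
exact: ternary_partial_nd.
Qed.

Lemma ternaryE c :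
  ternary c = (c 0%N)%:R * 2 / 3 + ternary (fun k => c k.+1) / 3.
Proof.
have h1 : (fun n => ternary_partial c n.+1) @ \oo --> ternary c.
  by rewrite (cvg_shiftS (ternary_partial c)); exact: ternary_cvg.
apply: (cvg_unique _ h1) => //.
rewrite (_ : (fun n => _) = fun n =>
    (c 0%N)%:R * 2 / 3 + ternary_partial (fun k => c k.+1) n / 3).
  apply: cvgD; first exact: cvg_cst.
  by apply: cvgMl; exact: ternary_cvg.
by apply/funext => n; exact: ternary_partialS.
Qed.

(** The shift of the expansion by [k] digits. A tail lies in [[0, 1/3]] or in [[2/3, 1]] according
    to its leading digit, so the threshold 1/2 reads that digit off. *)
Fixpoint ternary_tail (k : nat) (y : R) : R := if k is k'.+1 then
  3 * ternary_tail k' y - (if 2^-1 < ternary_tail k' y then 2 else 0) else y.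

Lemma measurable_ternary_tail k : measurable_fun setT (ternary_tail k).
Proof.
elim: k => [|k ih]; first exact: measurable_id.
apply: measurable_funB; first exact: measurable_funM.
by apply: measurable_fun_ifT => //; exact: measurable_fun_ltr.
Qed.

Lemma ternary_digit c k : (2^-1 < ternary_tail k (ternary c)) = c k.
Proof.
have tailE j : ternary_tail j (ternary c) = ternary (fun m => c (j + m)%N).
  elim: j => //= j ->; have := ternaryE (fun m => c (j + m)%N).
  have := ternary01 (fun m => c (j + m.+1)%N); rewrite addn0.
  under [X in ternary X]funext do rewrite addnS -addSn.
  case: (c j) => /= /andP[t0 t1] ->; case: ltrP; lra.
rewrite tailE; have := ternaryE (fun m => c (k + m)%N).
have := ternary01 (fun m => c (k + m.+1)%N); rewrite addn0.
by case: (c k) => /= /andP[t0 t1] ->; case: ltrP; lra.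
Qed.

End TernaryCode.

Section Separability.
Context d (T : measurableType d) (R : realType) (mu : probability T R).
Local Open Scope ereal_scope.

Lemma measure_setY_triangle A B C :
  measurable A -> measurable B -> measurable C ->
  mu (A `+` C) <= mu (A `+` B) + mu (B `+` C).
Proof.
move=> mA mB mC.
have mY (X Z : set T) : measurable X -> measurable Z -> measurable (X `+` Z).
  by move=> mX mZ; rewrite setY_def; apply: measurableU; exact: measurableD.
apply: (le_trans _ (measureU2 _ (mY _ _ mA mB) (mY _ _ mB mC))).
apply: le_measure; rewrite ?inE; [exact: mY|apply: measurableU; exact: mY|].
rewrite !setY_def => x [[Ax nC]|[Cx nA]].
  by have [Bx|nB] := pselect (B x); [right; left|left; left].
by have [Bx|nB] := pselect (B x); [left; right|right; right].
Qed.

(** A node denotes the complement of the union of its children, which suffices for all Boolean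
    combinations of the [V k]; trees serve as codes because they form a countable type. The node
    label carries no meaning. *)
Fixpoint nor_eval (V : nat -> set T) (t : GenTree.tree nat) : set T :=
  match t with
  | GenTree.Leaf k => V k
  | GenTree.Node _ l => ~` foldr (fun t A => nor_eval V t `|` A) set0 l
  end.

Lemma measurable_nor_eval V t :
  (forall k, measurable (V k)) -> measurable (nor_eval V t).
Proof.
move=> mV; move: t; fix ih 1 => -[k|n l] /=; first exact: mV.
apply: measurableC; elim: l => [|t l ihl] /=; first exact: measurable0.
by apply: measurableU => //; exact: ih.
Qed.

(** Sets of the line whose pull-back is approximable by Boolean combinations of rational rays form a
    sigma-algebra containing the rays. A countable union is first replaced by a finite one, by
    continuity of the measure from above. *)
Lemma measurable_separable : standard_borel R T ->
  exists2 E : GenTree.tree nat -> set T, (forall t, measurable (E t)) &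
    forall A, measurable A -> forall e, 0 < e -> exists t, mu (A `+` E t) < e.
Proof.
move=> [i [g [mi [mg [_ gi]]]]].
have mi' C : measurable C -> measurable (i @^-1` C).
  by move=> mC; rewrite -[X in measurable X]setTI; exact: mi.
pose q n : R := ratr (odflt 0%R (unpickle n : option rat)).
pose V n := i @^-1` `]-oo, q n[%classic.
have mV n : measurable (V n) by apply: mi'.
exists (nor_eval V) => [t|A mA]; first exact: measurable_nor_eval.
pose K := [set C : set R | measurable C /\ forall e, 0 < e ->
  exists t, mu ((i @^-1` C) `+` nor_eval V t) < e].
have mY (X Z : set T) : measurable X -> measurable Z -> measurable (X `+` Z).
  by move=> mX mZ; rewrite setY_def; apply: measurableU; exact: measurableD.
have mE t : measurable (nor_eval V t) by exact: measurable_nor_eval.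
have KC C : K C -> K (~` C).
  move=> [mC h]; split; first exact: measurableC.
  move=> e e0; have [t ht] := h e e0; exists (GenTree.Node 0 [:: t]) => /=.
  suff -> : (i @^-1` (~` C)) `+` ~` (nor_eval V t `|` set0) =
            (i @^-1` C) `+` nor_eval V t by [].
  rewrite setU0 preimage_setC; apply/seteqP; rewrite !setY_def.
  split=> x [[h1 h2]|[h1 h2]]; [right|left|right|left]; split=> //;
    exact: contrapT.
have KU C D : K C -> K D -> K (C `|` D).
  move=> [mC h1] [mD h2]; split; first exact: measurableU.
  move=> e e0.
  have [e' e'0 ee] : exists2 e' : \bar R, 0 < e' & e' + e' <= e.
    case: e e0 => [r r0| |] //; last by exists +oo.
    exists (r / 2)%:E; first by rewrite lte_fin divr_gt0.
    by rewrite -EFinD -splitr.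
  have [t1 ht1] := h1 e' e'0; have [t2 ht2] := h2 e' e'0.
  exists (GenTree.Node 0 [:: GenTree.Node 0 [:: t1; t2]]) => /=.
  rewrite setU0 setU0 setCK.
  apply: (lt_le_trans _ ee); apply: (le_lt_trans _ (lteD ht1 ht2)).
  have m1 := mY _ _ (mi' _ mC) (mE t1); have m2 := mY _ _ (mi' _ mD) (mE t2).
  apply: (le_trans _ (measureU2 _ m1 m2)).
  apply: le_measure; rewrite ?inE; [|exact: measurableU|].
    apply: mY; last exact: measurableU.
    by apply: mi'; exact: measurableU.
  rewrite !setY_def => x [[[Cx|Dx] /not_orP[n1 n2]]|[[Ex|Ex] /not_orP[n1 n2]]].
  - by left; left.
  - by right; left.
  - by left; right.
  - by right; right.
have K0 : K set0.
  split=> // e e0.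
  exists (GenTree.Node 0 [:: GenTree.Node 0 [::]]) => /=.
  by rewrite setU0 setC0 setCT preimage_set0 setYK measure0.
have KUn (F : (set R)^nat) : (forall n, K (F n)) -> K (\bigcup_n F n).
  move=> HF; have mF n : measurable (F n) by have [] := HF n.
  split; first exact: bigcupT_measurable.
  pose W n := \bigcup_(k < n) F k.
  have KW n : K (W n).
    elim: n => [|n ih]; first by rewrite /W bigcup_mkord big_ord0.
    by rewrite /W bigcup_mkord big_ord_recr -bigcup_mkord; exact: KU.
  move=> e e0.
  have [e' e'0 ee] : exists2 e' : R, (0 < e')%R & (e' + e')%:E <= e.
    case: e e0 => [r r0| |] //; last by exists 1%R => //; rewrite leey.
    exists (r / 2)%R; first by rewrite divr_gt0.
    by rewrite -splitr.
  have mUF : measurable (\bigcup_n F n) by exact: bigcupT_measurable.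
  have mW n : measurable (W n) by have [] := KW n.
  have [n hn] : exists n, mu (i @^-1` (\bigcup_n F n) `+` i @^-1` W n) < e'%:E.
    pose Z n := i @^-1` (\bigcup_n F n) `\` i @^-1` W n.
    have mZ n : measurable (Z n) by apply: measurableD; exact: mi'.
    have Z0 : \bigcap_n Z n = set0.
      apply/seteqP; split=> // x h; have [[n _ Fn] _] := h 0%N I.
      by have [_] := h n.+1 I; apply; exists n => /=.
    have : mu \o Z @ \oo --> mu (\bigcap_n Z n).
      apply: nonincreasing_cvg_mu => //.
      - by rewrite (@le_lt_trans _ _ 1)// ?ltry// probability_le1.
      - by rewrite Z0.
      - move=> n m nm; apply/subsetPset => x [h1 h2]; split=> // -[k /= kn Fk].
        by apply: h2; exists k => //=; exact: leq_trans nm.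
    rewrite Z0 measure0 => /fine_cvgP[_ /cvgrPdist_lt/(_ _ e'0)].
    move=> [n _ /(_ n (leqnn n))] /=; rewrite sub0r normrN => hn.
    exists n; have -> : i @^-1` (\bigcup_n F n) `+` i @^-1` W n = Z n.
      rewrite setY_def; apply/seteqP; split=> x; last by left.
      by case=> // -[[k _ Fk] nF]; exfalso; apply: nF; exists k.
    rewrite -[X in X < _]fineK ?lte_fin.
      by apply: le_lt_trans hn; exact: ler_norm.
    rewrite ge0_fin_numE ?measure_ge0//.
    by rewrite (@le_lt_trans _ _ 1)// ?ltry// probability_le1.
  have [t ht] := (KW n).2 e'%:E e'0; exists t.
  apply: (le_lt_trans (measure_setY_triangle (mi' _ mUF) (mi' _ (mW n)) (mE t))).
  by apply: (lt_le_trans _ ee); rewrite EFinD; exact: lteD.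
have sK : sigma_algebra setT K.
  by split=> // C KC'; rewrite setTD; exact: KC.
have KA C : measurable C -> K C.
  rewrite [measurable](RGenInftyO.measurableE R).
  apply: (smallest_sub sK) => _ [x ->].
  rewrite (_ : `]-oo, x[%classic =
    \bigcup_n (if (q n < x)%R then `]-oo, q n[%classic else set0)).
    apply: KUn => n; case: ifPn => // _; split=> // e e0.
    by exists (GenTree.Leaf n) => /=; rewrite setYK measure0.
  apply/seteqP; split=> y /=.
    rewrite in_itv/= => /rat_in_itvoo[r]; rewrite in_itv/= => /andP[yr rx].
    by exists (pickle r) => //; rewrite /q pickleK /= rx /= in_itv.
  move=> [n _]; case: ifPn => // nx /=; rewrite !in_itv/= => yq.
  exact: lt_trans nx.
have [_ h] := KA (g @^-1` A) (eq_ind _ measurable (mg measurableT _ mA) _ (setTI _)).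
move=> e e0; have [t ht] := h e e0; exists t.
suff <- : i @^-1` (g @^-1` A) = A by [].
by apply/seteqP; split=> x /=; rewrite gi.
Qed.

End Separability.

Section SubSigmaAlgebra.
Context d (T : measurableType d) (R : realType) (mu : probability T R).
Variable I : set (set T).
Hypothesis sT : standard_borel R T.
Hypothesis sI : sigma_algebra setT I.
Hypothesis mI : forall A, I A -> measurable A.

(* Modulo null sets every sub-sigma-algebra of a standard probability space is
   generated by one real function: take a countable dense subset of it for the
   distance [mu (A `+` B)] and read off the digits. *)
Lemma sub_sigma_algebra_generator : exists p : T -> R,
  (forall B, measurable B -> I (p @^-1` B)) /\
  forall A, I A -> exists2 B, measurable B & mu.-negligible (A `+` p @^-1` B).
Proof.
have [D mD dD] := measurable_separable mu sT.
(* Two errors [e n], from [D t] to [A] and from [D t] to the chosen set, add up to [1 / 2 ^ n.+1],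
   which is summable as Borel-Cantelli requires. *)
pose e n : R := 1 / (2 ^ n.+2)%:R.
(* The sets [D t] need not belong to [I]. For each pair [(t, n)] a member of [I] within [e n] of
   [D t] is selected whenever one exists; these members are the countable dense subset. *)
have /choice[X HX] (k : nat) : exists X, I X /\
    if (unpickle k : option (GenTree.tree nat * nat)) is Some (t, n)
    then (exists2 X', I X' & (mu (X' `+` D t) < (e n)%:E)%E) ->
      (mu (X `+` D t) < (e n)%:E)%E else True.
  case: unpickle => [[t n]|]; last by exists set0; split=> //; case: sI.
  have [[X' IX h]|h] := pselect (exists2 X', I X' & (mu (X' `+` D t) < (e n)%:E)%E).
    by exists X'.
  by exists set0; split=> //; case: sI.
have mX k : measurable (X k) by apply: mI; have [] := HX k.
pose p x : R := ternary R (fun k => x \in X k).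
(* Measurability is proved for the sigma-algebra generated by [I], which is [I] itself, so that
   preimages under [p] belong to [I] and are not merely measurable. *)
have mp : measurable_fun setT (p : g_sigma_algebraType I -> R).
  apply: (@measurable_fun_cvg _ (g_sigma_algebraType I) R setT
      (fun n x => ternary_partial R (fun k => (x : T) \in X k) n)).
    move=> n; apply: measurable_sum => k; apply: measurable_funM => //.
    apply: measurable_funM => //.
    rewrite (_ : (fun _ => _) = \1_(X k)); last by [].
    apply: measurable_indic; apply: sub_gen_smallest.
    by have [] := HX k.
  by move=> x _; exact: ternary_cvg.
exists p; split=> [B mB|A IA].
  by have := mp measurableT B mB; rewrite setTI /measurable/= sigma_algebra_id.
have mA := mI IA.
have e0 n : 0 < e n by rewrite divr_gt0// ltr0n expn_gt0.
have mY (Y Z : set T) : measurable Y -> measurable Z -> measurable (Y `+` Z).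
  by move=> mX' mZ; rewrite setY_def; apply: measurableU; exact: measurableD.
have /choice[k Hk] (n : nat) : exists k,
    (mu (A `+` X k) <= (1 / (2 ^ n.+1)%:R)%:E)%E.
  have e0' : (0 < (e n)%:E :> \bar R)%E by rewrite lte_fin.
  have [t ht] := dD A mA _ e0'; exists (pickle (t, n)).
  have [_] := HX (pickle (t, n)); rewrite pickleK => /(_ _)/wrap[].
    by exists A.
  move=> hX; have mt : measurable (D t) by [].
  apply: (le_trans (measure_setY_triangle mu mA mt (mX _))).
  apply: (@le_trans _ _ ((e n)%:E + (e n)%:E)%E).
    by apply: leeD; rewrite ltW// setYC.
  by rewrite -EFinD lee_fin /e expnS natrM invfM; lra.
pose C n := [set y | 2^-1 < ternary_tail (k n) y] : set R.
have mC n : measurable (C n).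
  have : measurable_fun setT (fun y : R => 2^-1 < ternary_tail (k n) y).
    by apply: measurable_fun_ltr => //; exact: measurable_ternary_tail.
  by move=> /(_ measurableT [set true] Logic.I); rewrite setTI.
(* [C n] decodes [X (k n)] from the value of [p]. By Borel-Cantelli almost every point lies in only
   finitely many of the symmetric differences of [A] and [X (k n)], so [A] agrees almost everywhere
   with their upper limit. *)
exists (lim_sup_set C).
  by apply: bigcapT_measurable => n; apply: bigcup_measurable.
pose Z n := A `+` X (k n).
have mZ n : measurable (Z n) by exact: mY.
apply: (@negligibleS _ _ _ _ (lim_sup_set Z)); last first.
  apply/negligibleP.
    by apply: bigcapT_measurable => n; apply: bigcup_measurable.
  apply: lim_sup_set_cvg0 => //.
  apply: (@le_lt_trans _ _ 1%:E); last exact: ltry.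
  have := @epsilon_trick R (fun=> 0%E) 1 xpredT (fun=> lexx _) ler01.
  rewrite [X in (_ <= X + _)%E -> _]eseries0// add0e; apply: le_trans.
  by apply: lee_nneseries => // n _; rewrite add0e; exact: Hk.
have pC x n : C n (p x) <-> X (k n) x.
  rewrite /C /= /p ternary_digit; split; [exact: set_mem|exact: mem_set].
rewrite setY_def => x [[Ax /= nC]|[/= Cx nA]].
  have [n hn] : exists n, forall j, (n <= j)%N -> ~ C j (p x).
    apply: contrapT => h; apply: nC => n _; apply: contrapT => h'.
    by apply: h; exists n => j nj Cj; apply: h'; exists j.
  move=> m _; exists (maxn n m); rewrite /= ?leq_maxr// /Z setY_def; left.
  by split=> // /pC; apply: hn; exact: leq_maxl.
move=> m _; have [j mj Cj] := Cx m Logic.I; exists j => //.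
by rewrite /Z setY_def; right; split=> //; apply/pC.
Qed.

End SubSigmaAlgebra.

Section SubSigmaFactor.
Context d (T : measurableType d) (R : realType) (mu : probability T R).
Variable I : set (set T).
Hypothesis sT : standard_borel R T.
Hypothesis sI : sigma_algebra setT I.
Hypothesis mI : forall A, I A -> measurable A.

Lemma sub_sigma_algebra_factor : exists p : T -> R,
  (forall B, measurable B -> I (p @^-1` B)) /\
  forall d' (Z : measurableType d') (h : T -> Z), standard_borel R Z ->
    (forall C, measurable C -> I (h @^-1` C)) ->
    exists2 F : R -> Z, measurable_fun setT F &
      mu.-negligible [set x | h x <> F (p x)].
Proof.
have [p [pI pA]] := sub_sigma_algebra_generator mu sT sI mI.
exists p; split=> // d' Z h sZ hI; apply: ae_factor => // C mC.
have [B mB B0] := pA _ (hI C mC); exists B => //.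
apply: negligibleS B0 => x nx; rewrite setY_def.
have [Ch|nC] := pselect (C (h x)).
  by left; split=> // Bp; apply: nx; split.
by right; split=> //; apply: contrapT => nB; apply: nx; split.
Qed.

End SubSigmaFactor.

(** * Measurability with countable codomain, and the standard Borel space [R * nat] *)

Section CountableCodomain.
Context d (X : measurableType d).

Lemma measurable_fun_nat (f : X -> nat) :
  (forall n, measurable (f @^-1` [set n])) -> measurable_fun setT f.
Proof.
move=> mf _ B _; rewrite setTI.
rewrite (_ : _ @^-1` _ = \bigcup_(n in B) f @^-1` [set n]).
  by apply: bigcup_measurable => n _.
by apply/seteqP; split=> [x Bx|x [n Bn /= fx]]; [exists (f x)|rewrite /= fx].
Qed.

Lemma measurable_fun_from_nat d' (Y : measurableType d') (f : X -> nat)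
    (h : nat -> X -> Y) : measurable_fun setT f ->
  (forall n, measurable_fun setT (h n)) ->
  measurable_fun setT (fun x => h (f x) x).
Proof.
move=> mf mh _ B mB; rewrite setTI.
rewrite (_ : _ @^-1` _ = \bigcup_n (f @^-1` [set n] `&` h n @^-1` B)).
  apply: bigcupT_measurable => n; apply: measurableI.
    by rewrite -[X in measurable X]setTI; exact: mf.
  by rewrite -[X in measurable X]setTI; exact: mh.
by apply/seteqP; split=> [x Bx|x [n _ [/= <-]]//]; exists (f x).
Qed.

Lemma measurable_fun_asbool (P : set X) : measurable P ->
  measurable_fun setT (fun x => `[< P x >]).
Proof.
move=> mP; apply: (measurable_fun_bool true); rewrite setTI.
rewrite (_ : _ @^-1` _ = P)//.
by apply/seteqP; split=> x /= => [/asboolP|/asboolP].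
Qed.

Lemma measurable_fun_ifP d' (Y : measurableType d') (P : set X) (f g : X -> Y) :
  measurable P -> measurable_fun P f -> measurable_fun setT g ->
  measurable_fun setT (fun x => if `[< P x >] then f x else g x).
Proof.
move=> mP mf mg; apply: measurable_fun_if => //.
- exact: measurable_fun_asbool.
- rewrite setTI (_ : _ @^-1` _ = P)//.
  by apply/seteqP; split=> x /= => [/asboolP|/asboolP].
- exact: measurable_funTS.
Qed.

End CountableCodomain.

(** The double exponential maps the line injectively into the open unit interval, and adding [n]
    separates the copies. Truncation and two logarithms decode. *)
Lemma standard_borel_real_nat (R : realType) :
  standard_borel R (R * nat)%type.
Proof.
pose f (q : R * nat) : R := q.2%:R + expR (- expR q.1).
pose t (y : R) : nat := Num.truncn `|y|.
pose g (y : R) : R * nat := (ln (- ln (`|y| - (t y)%:R)), t y).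
have mnat : measurable_fun setT (fun n : nat => n%:R : R) by [].
have mt : measurable_fun setT t.
  apply: measurable_fun_nat => n.
  have -> : t @^-1` [set n] = [set y : R | (n%:R <= `|y|) && (`|y| < n.+1%:R)].
    by apply/seteqP; split=> y /=; rewrite /t -truncn_eq//; move/eqP.
  have : measurable_fun setT
      (fun y : R => (n%:R <= `|y|) && (`|y| < n.+1%:R)).
    by apply: measurable_and; [apply: measurable_fun_ler|apply: measurable_fun_ltr].
  by move=> /(_ measurableT [set true] I); rewrite setTI.
have mf : measurable_fun setT f.
  apply: measurable_funD; first exact: measurableT_comp mnat measurable_snd.
  apply: (measurableT_comp (@measurable_expR R)); apply: measurable_funN.
  exact: measurableT_comp (@measurable_expR R) measurable_fst.
have mg : measurable_fun setT g.
  apply: measurable_fun_pair => //.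
  apply: (measurableT_comp (@measurable_ln R)); apply: measurable_funN.
  apply: (measurableT_comp (@measurable_ln R)); apply: measurable_funB => //.
  exact: measurableT_comp mnat mt.
have gf q : g (f q) = q.
  case: q => z n; have e0 := expR_gt0 (- expR z); have z0 := expR_gt0 z.
  have e1 : expR (- expR z) < 1 by rewrite expR_lt1 oppr_lt0.
  have f0 : 0 <= f (z, n) by rewrite /f/= addr_ge0// ltW.
  have tn : t (f (z, n)) = n.
    apply/eqP; rewrite /t truncn_eq// ger0_norm// /f/= lerDl ltW//=.
    by rewrite -natr1 ltrD2l.
  rewrite /g tn ger0_norm// /f/= addrAC subrr add0r expRK opprK expRK.
  by [].
exists f, g; split=> //; split=> //; split=> //.
(* Since [g] is a left inverse of [f], the range is the fixed-point set of [f \o g], which is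
   visibly Borel. *)
rewrite (_ : range f = [set y | f (g y) == y]).
  have : measurable_fun setT (fun y => f (g y) == y).
    by apply: measurable_fun_eqr => //; exact: measurableT_comp.
  by move=> /(_ measurableT [set true] I); rewrite setTI.
apply/seteqP; split=> [_ [q _ <-]|y /= /eqP <-]; first by rewrite /= gf.
by exists (g y).
Qed.

Lemma standard_borel_real (R : realType) : standard_borel R R.
Proof.
exists id, id; split; first exact: measurable_id.
split; first exact: measurable_id.
by split=> //; rewrite image_id.
Qed.

(** * Groupoid algebra and choice functions *)

Section GroupoidTheory.
Context d (T : measurableType d) (G : grpd T).
Local Notation U := (gunit G).
Local Notation r := (gr G).
Local Notation s := (gs G).
Local Notation mul := (gmul G).
Local Notation inv := (ginv G).
Hypothesis ax : groupoid_axioms G.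

Lemma gunit_r g : U (r g). Proof. by case: ax => -[/(_ g)[]]. Qed.
Lemma gunit_s g : U (s g). Proof. by case: ax => -[/(_ g)[]]. Qed.
Lemma gr_unit u : U u -> r u = u. Proof. by case: ax => -[_ h] _ _ _ _ /h[]. Qed.
Lemma gs_unit u : U u -> s u = u. Proof. by case: ax => -[_ h] _ _ _ _ /h[]. Qed.
Lemma gr_gr g : r (r g) = r g. Proof. exact/gr_unit/gunit_r. Qed.
Lemma gs_gr g : s (r g) = r g. Proof. exact/gs_unit/gunit_r. Qed.
Lemma gr_gs g : r (s g) = s g. Proof. exact/gr_unit/gunit_s. Qed.
Lemma gs_gs g : s (s g) = s g. Proof. exact/gs_unit/gunit_s. Qed.

Lemma gr_mul g h : s g = r h -> r (mul g h) = r g.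
Proof. by case: ax => _ H _ _ _ /H[]. Qed.
Lemma gs_mul g h : s g = r h -> s (mul g h) = s h.
Proof. by case: ax => _ H _ _ _ /H[]. Qed.
Lemma gmulA g h k : s g = r h -> s h = r k ->
  mul (mul g h) k = mul g (mul h k).
Proof. by case: ax => _ _ H _ _; exact: H. Qed.
Lemma gmul_r g : mul (r g) g = g. Proof. by case: ax => _ _ _ /(_ g)[]. Qed.
Lemma gmul_s g : mul g (s g) = g. Proof. by case: ax => _ _ _ /(_ g)[]. Qed.
Lemma gr_inv g : r (inv g) = s g. Proof. by case: ax => _ _ _ _ /(_ g)[]. Qed.
Lemma gs_inv g : s (inv g) = r g. Proof. by case: ax => _ _ _ _ /(_ g)[_ []]. Qed.
Lemma gmulV g : mul g (inv g) = r g.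
Proof. by case: ax => _ _ _ _ /(_ g)[_ [_ []]]. Qed.
Lemma gmulVg g : mul (inv g) g = s g.
Proof. by case: ax => _ _ _ _ /(_ g)[_ [_ []]]. Qed.

Lemma gmulKV g h : r g = r h -> mul g (mul (inv g) h) = h.
Proof.
by move=> gh; rewrite -gmulA ?gr_inv ?gs_inv// gmulV gh gmul_r.
Qed.
Lemma gmulVK g h : s g = r h -> mul (inv g) (mul g h) = h.
Proof.
by move=> gh; rewrite -gmulA ?gs_inv// gmulVg gh gmul_r.
Qed.
Lemma gmulK g h : s g = r h -> mul (mul g h) (inv h) = g.
Proof. by move=> gh; rewrite gmulA ?gr_inv// gmulV -gh gmul_s. Qed.

Lemma gmul_insert u a q g : s u = r a -> s a = r q -> r q = r g ->
  mul (mul u (mul a q)) (mul (inv q) g) = mul u (mul a g).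
Proof.
move=> ua aq qg; have qVg : s (inv q) = r g by rewrite gs_inv.
have qqV : s q = r (mul (inv q) g) by rewrite gr_mul// gr_inv.
have c1 : s u = r (mul a q) by rewrite gr_mul.
have c2 : s (mul a q) = r (mul (inv q) g) by rewrite gs_mul.
by rewrite (gmulA c1 c2) (gmulA aq qqV) gmulKV.
Qed.

Lemma ginv_unique g h : s g = r h -> mul g h = r g -> h = inv g.
Proof. by move=> gh e; rewrite -(gmulVK gh) e -gs_inv gmul_s. Qed.

Lemma ginvK g : inv (inv g) = g.
Proof. by apply/esym/ginv_unique; rewrite ?gs_inv// gmulVg gr_inv. Qed.

Lemma ginvM g h : s g = r h -> inv (mul g h) = mul (inv h) (inv g).
Proof.
move=> gh; have hg : s (inv h) = r (inv g) by rewrite gs_inv gr_inv.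
apply/esym/ginv_unique; first by rewrite gs_mul// gr_mul// gr_inv.
have e : s (mul g h) = r (inv h) by rewrite gs_mul// gr_inv.
by rewrite -(gmulA e hg) gmulK// gmulV gr_mul.
Qed.

Variable S : set T.
Hypothesis subS : borel_subgroupoid G S.

Lemma subgroupoidM g h : s g = r h -> S g -> S h -> S (mul g h).
Proof. by move=> gh Sg Sh; case: subS => _ _ + _; exact. Qed.
Lemma subgroupoidV g : S g -> S (inv g).
Proof. by case: subS => _ _ _; exact. Qed.
Lemma subgroupoid_unit u : U u -> S u.
Proof. by case: subS => _ + _ _; exact. Qed.
Lemma subgroupoidMl g h : s g = r h -> S g -> S (mul g h) <-> S h.
Proof.
move=> gh Sg; split=> [Sgh|]; last exact: subgroupoidM.
rewrite -(gmulVK gh); apply: subgroupoidM => //; first by rewrite gs_inv gr_mul.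
exact: subgroupoidV.
Qed.
Lemma subgroupoidMr g h : s g = r h -> S h -> S (mul g h) <-> S g.
Proof.
move=> gh Sh; split=> [Sgh|Sg]; last exact: subgroupoidM.
rewrite -(gmulK gh); apply: subgroupoidM => //; first by rewrite gr_inv gs_mul.
exact: subgroupoidV.
Qed.

End GroupoidTheory.

Section TotalMul.
Context d (T : measurableType d) (R : realType) (G : grpd T).

(* [gmul] is only measurable on composable pairs; this is a measurable total
   extension, with junk value [g] on the other pairs. *)
Definition total_gmul (g h : T) : T :=
  if `[< gs G g = gr G h >] then gmul G g h else g.

Lemma total_gmulE g h : gs G g = gr G h -> total_gmul g h = gmul G g h.
Proof. by move=> gh; rewrite /total_gmul ifT//; exact/asboolP. Qed.

Lemma standard_borel_measurable_eq d' (X : measurableType d') (f g : X -> T) :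
  standard_borel R T -> measurable_fun setT f -> measurable_fun setT g ->
  measurable [set x | f x = g x].
Proof.
move=> [i [j [mi [mj [_ ji]]]]] mf mg.
have : measurable_fun setT (fun x => i (f x) == i (g x)).
  by apply: measurable_fun_eqr; exact: measurableT_comp.
move=> /(_ measurableT [set true] I); rewrite setTI.
suff -> : [set x | f x = g x] = (fun x => i (f x) == i (g x)) @^-1` [set true].
  by [].
apply/seteqP; split=> x /= => [->|/eqP e]; first exact: eqxx.
by rewrite -(ji (f x)) e ji.
Qed.

Hypothesis dG : discrete_borel_groupoid G R.

Lemma measurable_composable :
  measurable [set p : T * T | gs G p.1 = gr G p.2].
Proof.
have [sT _ _ [mr ms] _] := dG; apply: standard_borel_measurable_eq => //.
  exact: measurableT_comp ms measurable_fst.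
exact: measurableT_comp mr measurable_snd.
Qed.

Lemma measurable_total_gmul d' (X : measurableType d') (f g : X -> T) :
  measurable_fun setT f -> measurable_fun setT g ->
  measurable_fun setT (fun x => total_gmul (f x) (g x)).
Proof.
move=> mf mg; have [_ _ _ _ [mm _ _]] := dG.
have mfg : measurable_fun setT (fun x => (f x, g x)) by exact: measurable_fun_pair.
apply: (@measurableT_comp _ _ _ _ _ _
  (fun p : T * T => total_gmul p.1 p.2) setT (fun x => (f x, g x))) => //.
exact: measurable_fun_ifP measurable_composable mm measurable_fst.
Qed.

End TotalMul.

Section NormalChoice.
Context d (T : measurableType d) (R : realType) (G : grpd T)
  (mu : probability T R) (S : set T).
Local Notation U := (gunit G).
Local Notation r := (gr G).
Local Notation s := (gs G).
Local Notation mul := (gmul G).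
Local Notation inv := (ginv G).
Hypothesis dG : discrete_measured_groupoid G mu.

Lemma conull_nonempty (X : set T) : measurable X -> mu (~` X) = 0%E -> X !=set0.
Proof.
move=> mX X0; apply/set0P/eqP => XE; move: X0.
by rewrite XE setC0 probability_setT => /eqP; rewrite onee_eq0.
Qed.

(** Replaces the almost-everywhere data of normality by a sequence of Borel maps whose properties
    hold without exception over one invariant conull set. *)
Lemma normal_subgroupoid_choice : normal_subgroupoid G mu S ->
  exists (X0 : set T) (p : nat -> T -> T),
  [/\ invariant_conull G mu X0,
      forall n, measurable_fun setT (p n),
      forall n x, X0 x -> r (p n x) = x,
      forall g, X0 (r g) -> exists n, S (mul (inv (p n (r g))) g) &
      forall n g, S g -> X0 (r g) ->
        S (mul (inv (p n (r g))) (mul g (p n (s g))))].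
Proof.
move=> [subS [F [cF FEnd Fae]]]; have [bG muU _] := dG.
have [_ ax mU _ _] := bG.
(* If [F] were empty, the choice condition would fail at every unit, making [U] null along with its
   complement. The member [F0] is needed to pad the enumeration of [F]. *)
have [F0 FF0] : F !=set0.
  apply/set0P/eqP => FE.
  have U0 : mu.-negligible U.
    apply: negligibleS Fae => x Ux /= /(_ Ux x)[]; first exact: (gr_unit ax Ux).
    by move=> phi [[]]; rewrite FE.
  have [x Ux] := conull_nonempty (measurableC mU)
    (etrans (congr1 mu (setCK _)) (measure_negligible mU U0)).
  by have [y Uy] := conull_nonempty mU muU; have : mu setT = 0%E;
    [rewrite -(setUv U); apply: measure_negligible;
       [apply: measurableU => //; exact: measurableC|
        apply: negligibleU => //; apply/negligibleP => //; exact: measurableC]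
    |rewrite probability_setT => /eqP; rewrite onee_eq0].
have [e Fe] : exists e : nat -> set T, forall phi, F phi <-> exists n, e n = phi.
  have /pcard_surjP[e0 e0F] := cF.
  exists (fun n => if `[< F (e0 n) >] then e0 n else F0) => phi; split.
    move=> Fphi; have [n _ en] := e0F phi Fphi; exists n; rewrite ifT//.
    by apply/asboolP; rewrite en.
  by move=> [n <-]; case: ifPn => // /asboolP.
have eF n : F (e n) by apply/Fe; exists n.
have eE n := FEnd _ (eF n).
have /choice[p Hp] n : exists p : T -> T, measurable_fun setT p /\
    mu.-negligible [set x | ~ (e n (p x) /\ r (p x) = x)].
  have [+ _] := eE n => /(full_r_section_measurable_choice dG)[p mp p0].
  by exists p.
pose B n := [set g | S g /\ exists h1 h2, [/\ e n h1, e n h2, r h1 = r g,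
  r h2 = s g & ~ S (mul (inv h1) (mul g h2))]].
have B0 n : mu.-negligible (r @` B n).
  by have [_ /(GnullP _ bG)] := eE n.
(* Three kinds of bad units: some [p n] does not select from its section, some section conjugates an
   arrow of [S] out of [S], or the choice condition fails. *)
have N0 := negligibleU (negligibleU
  (negligible_bigcup (fun n => (Hp n).2)) (negligible_bigcup B0)) Fae.
have [X0 [iX0 X0N]] := invariant_conull_sub dG N0.
have [mX0 X0U _ X0rs] := iX0.
have pe n x : X0 x -> e n (p n x) /\ r (p n x) = x.
  move=> Xx; apply: contrapT => h; apply: (X0N x Xx); left; left.
  by exists n.
exists X0, p; split=> //.
- by move=> n; have [] := Hp n.
- by move=> n x /(pe n)[].
- move=> g Xg; have [P|nP] := pselect (forall h, r h = r g -> exists! phi, F phi /\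
      exists k, [/\ phi k, r k = r g & simS G S h k]).
    have [phi [[/Fe[n <-] [k [ek rk Sk]]] _]] := P g erefl.
    exists n; suff -> : p n (r g) = k by [].
    have [[_ inj _] _] := eE n; have [e1 e2] := pe n _ Xg.
    by apply: inj; rewrite ?inE// e2 rk.
  by exfalso; apply: (X0N _ Xg); right => /= h; apply: nP; exact/h/gunit_r.
- move=> n g Sg Xg; apply: contrapT => nS; apply: (X0N _ Xg); left; right.
  exists n => //; exists g => //; split=> //.
  have [e1 e2] := pe n _ Xg; have [e3 e4] := pe n _ ((X0rs g).1 Xg).
  by exists (p n (r g)), (p n (s g)).
Qed.

End NormalChoice.

(** * The coset index and the quotient map *)

Section CosetIndex.
Context d (T : measurableType d) (R : realType) (G : grpd T)
  (mu : probability T R) (S : set T).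
Local Notation U := (gunit G).
Local Notation r := (gr G).
Local Notation s := (gs G).
Local Notation mul := (gmul G).
Local Notation inv := (ginv G).
Hypothesis dG : discrete_measured_groupoid G mu.
Hypothesis subS : borel_subgroupoid G S.
Variables (X0 : set T) (p : nat -> T -> T).
Hypothesis iX0 : invariant_conull G mu X0.
Hypothesis mp : forall n, measurable_fun setT (p n).
Hypothesis rp : forall n x, X0 x -> r (p n x) = x.
Hypothesis pS : forall g, X0 (r g) -> exists n, S (mul (inv (p n (r g))) g).
Hypothesis pN : forall n g, S g -> X0 (r g) ->
  S (mul (inv (p n (r g))) (mul g (p n (s g)))).

Let bG : discrete_borel_groupoid G R. Proof. by case: dG. Qed.
Let ax : groupoid_axioms G. Proof. by case: bG. Qed.
Let sT : standard_borel R T. Proof. by case: bG. Qed.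
Let mr : measurable_fun setT r. Proof. by case: bG => _ _ _ []. Qed.
Let ms : measurable_fun setT s. Proof. by case: bG => _ _ _ []. Qed.
Let minv : measurable_fun setT inv. Proof. by case: bG => _ _ _ _ []. Qed.
Let mS : measurable S. Proof. by case: subS. Qed.
Let mX0 : measurable X0. Proof. by case: iX0. Qed.
Let X0rs g : X0 (r g) <-> X0 (s g). Proof. by case: iX0 => _ _ _; exact. Qed.

Definition coset_mem n g := S (total_gmul G (inv (p n (r g))) g).

(** The padded enumeration may list a section several times, so several indices can name one coset;
    the least one is canonical. *)
Definition coset_least g : set nat :=
  [set n | coset_mem n g /\ forall m, coset_mem m g -> (n <= m)%N].

Definition coset_index g := xget 0%N (coset_least g).

Lemma composable_p n g : X0 (r g) -> s (inv (p n (r g))) = r g.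
Proof. by move=> Xg; rewrite (gs_inv ax) rp. Qed.

Lemma coset_memE n g : X0 (r g) ->
  coset_mem n g <-> S (mul (inv (p n (r g))) g).
Proof. by move=> Xg; rewrite /coset_mem total_gmulE// composable_p. Qed.

Lemma coset_indexP g : X0 (r g) -> S (mul (inv (p (coset_index g) (r g))) g).
Proof.
move=> Xg; rewrite -coset_memE// /coset_index.
have ex : exists n, `[< coset_mem n g >].
  by have [n Sn] := pS Xg; exists n; apply/asboolP/coset_memE.
have [n /asboolP n1 n2] := ex_minnP ex.
suff : coset_least g n by move=> /(xgetI 0%N)[].
by split=> // m gm; apply: n2; exact/asboolP.
Qed.

Lemma coset_index_eq g h : (forall n, coset_mem n g <-> coset_mem n h) ->
  coset_index g = coset_index h.
Proof.
move=> gh; congr xget; apply/seteqP.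
by split=> n [h1 h2]; (split; first exact/gh) => m /gh/h2.
Qed.

(** Right multiplication by [b] does not change the coset. On the left, insert [p n (s a)] and its
    inverse after [a]: the new first factor, the conjugate of [a] by the [n]-th section, lies in [S]
    by normality, so [a] and [g] composed lie in the same coset class as [g], index by index. *)
Lemma coset_index_mul a g b : S a -> S b -> s a = r g -> s g = r b ->
  X0 (r g) -> coset_index (mul (mul a g) b) = coset_index g.
Proof.
move=> Sa Sb ag gb Xg; apply: coset_index_eq => n.
have agb : s (mul a g) = r b by rewrite gs_mul.
have Xa : X0 (r a) by apply/X0rs; rewrite ag.
have ragb : r (mul (mul a g) b) = r a by rewrite !gr_mul.
have sp : s (inv (p n (r a))) = r a by exact: composable_p.
have raq : s a = r (p n (s a)) by rewrite rp// ag.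
have qg : r (p n (s a)) = r g by rewrite -raq.
have cu : s (inv (p n (r a))) = r (mul a g) by rewrite gr_mul.
rewrite !coset_memE ?ragb// -(gmulA ax cu agb).
rewrite (subgroupoidMr ax subS) ?gs_mul//.
have c1 : s (inv (p n (r a))) = r (mul a (p n (s a))) by rewrite (gr_mul ax raq).
have c2 : s (mul (inv (p n (r a))) (mul a (p n (s a)))) =
    r (mul (inv (p n (s a))) g).
  by rewrite (gs_mul ax c1) (gs_mul ax raq) gr_mul ?gr_inv// gs_inv.
rewrite -(gmul_insert ax sp raq qg) (subgroupoidMl ax subS c2) ?ag//.
by rewrite -ag; exact: pN.
Qed.

Lemma coset_index_Sr g b : S b -> s g = r b -> X0 (r g) ->
  coset_index (mul g b) = coset_index g.
Proof.
move=> Sb gb Xg; rewrite -(@coset_index_mul (r g) g b) ?gs_gr ?gmul_r//.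
exact/(subgroupoid_unit subS)/gunit_r.
Qed.

Lemma coset_decomp g : X0 (r g) -> exists t, [/\ S t,
  s (p (coset_index g) (r g)) = r t & mul (p (coset_index g) (r g)) t = g].
Proof.
move=> Xg; exists (mul (inv (p (coset_index g) (r g))) g); split.
- exact: coset_indexP.
- by rewrite gr_mul ?gr_inv ?gs_inv ?rp.
- by rewrite gmulKV ?rp.
Qed.

Lemma measurable_coset_index : measurable_fun setT coset_index.
Proof.
have mM n : measurable (coset_mem n).
  have : measurable_fun setT (fun g => total_gmul G (inv (p n (r g))) g).
    apply: (measurable_total_gmul bG) => //.
    apply: (measurableT_comp minv); exact: measurableT_comp (mp n) mr.
  by move=> /(_ measurableT S mS); rewrite setTI.
pose L n := coset_mem n `\` \bigcup_(m < n) coset_mem m.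
have mL n : measurable (L n).
  by apply: measurableD => //; apply: bigcup_measurable.
have LE n g : L n g <-> coset_least g n.
  split=> [[gn h]|[gn h]]; split=> //.
    by move=> m gm; rewrite leqNgt; apply/negP => mn; apply: h; exists m.
  by move=> [m /= mn /h]; rewrite leqNgt mn.
have L_index n g : L n g -> coset_index g = n.
  move=> /LE Lg; have [h1 h2] := xgetI 0%N Lg.
  by apply/eqP; rewrite eqn_leq h2 ?Lg.2//; case: Lg.
have index_L n g : coset_index g = n -> n != 0%N -> L n g.
  by rewrite /coset_index; case: xgetP => [m _ /LE Lm <-//|_ <-].
apply: measurable_fun_nat => n.
(* The value 0 is also the default of [xget], so its level set is the complement of the others. *)
have -> : coset_index @^-1` [set n] =
    if n == 0%N then ~` \bigcup_m L m.+1 else L n.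
  apply/seteqP; case: eqP => [->|/eqP n0]; split=> g /=.
  - by move=> g0 [m _ /L_index]; rewrite g0.
  - move=> nL; apply/eqP; apply: contrapT => /negP g0; apply: nL.
    exists (coset_index g).-1 => //.
    by rewrite prednK ?lt0n//; exact: index_L.
  - by move=> gn; exact: index_L.
  - exact: L_index.
by case: ifP => _ //; apply/measurableC/bigcupT_measurable.
Qed.

Definition invariant_sigma : set (set T) := [set E | measurable E /\
  forall g, S g -> X0 (r g) -> (E (r g) <-> E (s g))].

Lemma sigma_algebra_invariant : sigma_algebra setT invariant_sigma.
Proof.
split=> [|A [mA hA]|F HF]; first by split.
  split; first by rewrite setTD; exact: measurableC.
  by move=> g Sg Xg; split=> -[_ nA]; split=> // /(hA g Sg Xg).
split; first by apply: bigcupT_measurable => n; have [] := HF n.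
by move=> g Sg Xg; split=> -[n _ Fn]; exists n => //;
  have [_ h] := HF n; apply/(h g Sg Xg).
Qed.

Variable pi : T -> R.
Hypothesis pi_inv : forall B, measurable B -> invariant_sigma (pi @^-1` B).
Hypothesis pi_factor : forall d' (Z : measurableType d') (h : T -> Z),
  standard_borel R Z ->
  (forall C, measurable C -> invariant_sigma (h @^-1` C)) ->
  exists2 F : R -> Z, measurable_fun setT F &
    mu.-negligible [set x | h x <> F (pi x)].

Definition quotient_map g : R * nat := (pi (r g), coset_index g).

Lemma measurable_pi : measurable_fun setT pi.
Proof. by move=> _ B mB; rewrite setTI; have [] := pi_inv mB. Qed.

Lemma measurable_quotient_map : measurable_fun setT quotient_map.
Proof.
apply: measurable_fun_pair; last exact: measurable_coset_index.
exact: measurableT_comp measurable_pi mr.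
Qed.

Lemma pi_S g : S g -> X0 (r g) -> pi (r g) = pi (s g).
Proof.
move=> Sg Xg; have [_ /(_ g Sg Xg)[+ _]] := pi_inv (measurable_set1 (pi (r g))).
by move=> /(_ erefl) /= ->.
Qed.

Definition congruence_invariant (X : set T) (V : Type) (f : T -> V) :=
  forall a g b, S a -> S b -> s a = r g -> s g = r b -> X (r g) ->
    f (mul (mul a g) b) = f g.

Lemma quotient_map_invariant : congruence_invariant X0 quotient_map.
Proof.
move=> a g b Sa Sb ag gb Xg; rewrite /quotient_map coset_index_mul//.
have agb : s (mul a g) = r b by rewrite gs_mul.
by rewrite !gr_mul// pi_S// ?ag//; apply/X0rs; rewrite ag.
Qed.

(** Over the two ends of an arrow [g] of [S], the arrows [p n (r g)] and [p n (s g)] differ by [g]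
    on the left and an element of [S] on the right. Thus composing [f] with [p n] gives an
    S-invariant function of units, to which [pi_factor] will apply. *)
Lemma congruence_invariant_p X V (f : T -> V) n g : invariant_conull G mu X ->
  X `<=` X0 -> congruence_invariant X f -> S g -> X (r g) ->
  f (p n (r g)) = f (p n (s g)).
Proof.
move=> [_ _ _ Xrs] XX0 fX Sg Xg; have X0g := XX0 _ Xg.
pose t := mul (inv (p n (r g))) (mul g (p n (s g))).
have St : S t by exact: pN.
have gp : s g = r (p n (s g)) by rewrite rp//; exact/X0rs.
have c1 : r (p n (r g)) = r (mul g (p n (s g))) by rewrite rp// gr_mul.
have c2 : s (p n (r g)) = r (mul (inv (p n (r g))) (mul g (p n (s g)))).
  by rewrite gr_mul ?gr_inv// gs_inv.
have tE : mul (p n (r g)) t = mul g (p n (s g)) by rewrite gmulKV.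
have st : s t = s (p n (s g)) by rewrite -(gs_mul ax c2) tE gs_mul.
rewrite -(@fX g (p n (s g)) (inv t))//.
- by rewrite -tE gmulK.
- exact: (subgroupoidV subS).
- by rewrite gr_inv.
- by rewrite rp//; [exact/Xrs|exact/X0rs].
Qed.

Lemma quotient_map_S g : S g -> X0 (r g) ->
  quotient_map (r g) = quotient_map g /\ quotient_map (s g) = quotient_map g.
Proof.
move=> Sg Xg; have Xs : X0 (s g) by exact/X0rs.
have Su u : U u -> S u by exact: (subgroupoid_unit subS).
split.
  rewrite -(@quotient_map_invariant (r g) (r g) g) ?gr_gr ?gs_gr//.
    by rewrite -{1}(gr_gr ax g) gmul_r ?gmul_r.
  exact/Su/gunit_r.
rewrite -(@quotient_map_invariant g (s g) (s g)) ?gr_gs ?gs_gs// ?gmul_s//.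
exact/Su/gunit_s.
Qed.

Lemma quotient_map_Sr g b : S b -> s g = r b -> X0 (r g) ->
  quotient_map (mul g b) = quotient_map g.
Proof. by move=> Sb gb Xg; rewrite /quotient_map coset_index_Sr// gr_mul. Qed.

(** If [g] and [r g] have the same index [n], then both the inverse of [p n (r g)] and its product
    with [g] lie in [S]; cancelling leaves [g] in [S]. *)
Lemma quotient_map_kernel g : X0 (r g) ->
  quotient_map (r g) = quotient_map g <-> S g.
Proof.
move=> Xg; split=> [[_ e]|Sg]; last by have [] := quotient_map_S Sg Xg.
have Xr : X0 (r (r g)) by rewrite gr_gr.
have := coset_indexP Xr; have := coset_indexP Xg; rewrite gr_gr// -e.
move: (coset_index (r g)) => n; have c := composable_p n Xg.
have -> : mul (inv (p n (r g))) (r g) = inv (p n (r g)).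
  by rewrite -[in RHS](gmul_s ax (inv (p n (r g)))) c.
by move=> + h; rewrite subgroupoidMl.
Qed.

(** The right factor enters only through its index: [h] may be replaced by the representative with
    that index over [s g]. The product on the quotient is thus a countable family of one-variable
    maps. *)
Lemma quotient_map_mul g h : X0 (r g) -> s g = r h ->
  quotient_map (mul g h) =
  quotient_map (total_gmul G g (p (coset_index h) (s g))).
Proof.
move=> Xg gh; have Xh : X0 (r h) by rewrite -gh; exact/X0rs.
have [t [St pt tE]] := coset_decomp Xh.
have gp : s g = r (p (coset_index h) (r h)) by rewrite rp.
rewrite -{1}tE -(gmulA ax gp pt) quotient_map_Sr ?gs_mul ?gr_mul//.
by rewrite total_gmulE -?gh// rp// gh.
Qed.

Lemma congruence_invariant_r : congruence_invariant X0 (quotient_map \o r).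
Proof.
move=> a g b Sa Sb ag gb Xg /=; have agb : s (mul a g) = r b by rewrite gs_mul.
have Xa : X0 (r a) by apply/X0rs; rewrite ag.
have [e1 e2] := quotient_map_S Sa Xa.
by rewrite gr_mul// gr_mul// e1 -e2 ag.
Qed.

Lemma congruence_invariant_s : congruence_invariant X0 (quotient_map \o s).
Proof.
move=> a g b Sa Sb ag gb Xg /=; have agb : s (mul a g) = r b by rewrite gs_mul.
have Xb : X0 (r b) by rewrite -gb; exact/X0rs.
have [e1 e2] := quotient_map_S Sb Xb.
by rewrite gs_mul// e2 -e1 gb.
Qed.

Lemma congruence_invariant_inv : congruence_invariant X0 (quotient_map \o inv).
Proof.
move=> a g b Sa Sb ag gb Xg /=; have agb : s (mul a g) = r b by rewrite gs_mul.
have ba : s (inv b) = r (inv g) by rewrite gs_inv// gr_inv.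
have ga : s (inv g) = r (inv a) by rewrite gs_inv// gr_inv.
rewrite (ginvM ax agb) (ginvM ax ag) -(gmulA ax ba ga).
apply: quotient_map_invariant => //; try exact: (subgroupoidV subS).
by rewrite gr_inv//; exact/X0rs.
Qed.

(** Normality moves [b] past the representative: [b] times [p n (s b)] equals [p n (r b)] times an
    element [t] of [S]. *)
Lemma congruence_invariant_mulp n : congruence_invariant X0
  (fun g => quotient_map (total_gmul G g (p n (s g)))).
Proof.
move=> a g b Sa Sb ag gb Xg; have agb : s (mul a g) = r b by rewrite gs_mul.
have Xs : X0 (s g) by exact/X0rs.
have Xb : X0 (r b) by rewrite -gb.
have Xsb : X0 (s b) by exact/X0rs.
pose t := mul (inv (p n (r b))) (mul b (p n (s b))).
have bp : s b = r (p n (s b)) by rewrite rp.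
have gp : s g = r (p n (r b)) by rewrite rp.
have c1 : r (p n (r b)) = r (mul b (p n (s b))) by rewrite rp// gr_mul.
have c2 : s (p n (r b)) = r t by rewrite /t gr_mul ?gr_inv// gs_inv.
have tE : mul (p n (r b)) t = mul b (p n (s b)) by rewrite /t gmulKV.
have agp : s (mul a g) = r (p n (r b)) by rewrite gs_mul.
have agpr : s (mul (mul a g) b) = r (p n (s b)) by rewrite (gs_mul ax agb).
have gpr : s g = r (p n (s g)) by rewrite rp.
rewrite (gs_mul ax agb) (total_gmulE agpr) (total_gmulE gpr) gb.
rewrite (gmulA ax agb bp) -tE -(gmulA ax agp c2) (gmulA ax ag gp).
have St : S t by exact: pN.
by apply: quotient_map_invariant; rewrite ?(gr_mul ax gp) ?(gs_mul ax gp).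
Qed.

(** For each [n] the function [f \o p n] factors through [pi] almost everywhere, and [g] differs
    from its representative by an element of [S] on the right. The last clause also covers indices
    [n] that are not the coset index of [p n x]. *)
Lemma congruence_factor X d' (Z : measurableType d') (f : T -> Z) :
  invariant_conull G mu X -> X `<=` X0 -> standard_borel R Z ->
  measurable_fun setT f -> congruence_invariant X f ->
  exists (F : R * nat -> Z) (Y : set T),
  [/\ measurable_fun setT F, invariant_conull G mu Y, Y `<=` X,
      forall g, Y (r g) -> f g = F (quotient_map g) &
      forall n x, Y x -> f (p n x) = F (pi x, n)].
Proof.
move=> iX XX0 sZ mf fX; have [mX _ _ Xrs] := iX.
(* The constant value off [X] keeps [h n] invariant under [S] over all of [X0], since [X] is itself
   invariant. *)
pose h n x := if `[< X x >] then f (p n x) else point.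
have mh n : measurable_fun setT (h n).
  apply: measurable_fun_ifP => //; apply: measurable_funTS.
  exact: measurableT_comp mf (mp n).
have hI n C : measurable C -> invariant_sigma (h n @^-1` C).
  move=> mC; split; first by rewrite -[X in measurable X]setTI; exact: mh.
  move=> g Sg Xg; suff -> : (h n @^-1` C) (r g) = (h n @^-1` C) (s g) by [].
  rewrite /preimage /= /h; case: asboolP => [rX|nr].
    rewrite ifT; last by apply/asboolP/Xrs.
    by rewrite (congruence_invariant_p n iX XX0 fX Sg rX).
  by rewrite ifF//; apply/negP => /asboolP/Xrs.
have /choice[F HF] n : exists F : R -> Z, measurable_fun setT F /\
    mu.-negligible [set x | h n x <> F (pi x)].
  by have [F] := pi_factor sZ (hI n); exists F.
have [Y [iY YN]] :=
  invariant_conull_sub dG (negligible_bigcup (fun n => (HF n).2)).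
have hF n x : Y x -> h n x = F n (pi x).
  by move=> Yx; apply: contrapT => ne; apply: (YN _ Yx); exists n.
have fF n x : (X `&` Y) x -> f (p n x) = F n (pi x).
  by move=> [Xx Yx]; rewrite -hF// /h ifT//; exact/asboolP.
exists (fun q => F q.2 q.1), (X `&` Y); split=> //.
- apply: (measurable_fun_from_nat (h := fun n q => F n q.1)) => //.
  by move=> n; apply: measurableT_comp measurable_fst; have [] := HF n.
- exact: invariant_conullI.
move=> g XYg; have Xg := XYg.1; have [t [St pt tg]] := coset_decomp (XX0 _ Xg).
rewrite /quotient_map /= -fF//.
suff fE k : s k = r t -> mul k t = g -> r k = r g -> f g = f k.
  by apply: fE => //; rewrite rp//; exact: XX0.
move=> kt tE rk; rewrite -tE -(fX (r g) k t) ?gs_gr ?rk//.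
  by rewrite -rk gmul_r.
exact/(subgroupoid_unit subS)/gunit_r.
Qed.

End CosetIndex.

(** * The quotient groupoid *)

Section Pushforward.
Context d (T : measurableType d) d' (Y : measurableType d') (R : realType).
Variables (mu : probability T R) (f : T -> Y).
Hypothesis mf : measurable_fun setT f.

Definition pushforward_prob : probability Y R :=
  distribution mu (mfun_Sub (mem_set mf)).

Lemma pushforward_probE B : pushforward_prob B = mu (f @^-1` B).
Proof. by []. Qed.

Lemma pushforward_negligible N :
  pushforward_prob.-negligible N -> mu.-negligible (f @^-1` N).
Proof.
move=> [M [mM M0 NM]]; exists (f @^-1` M); split=> //.
  by rewrite -[X in measurable X]setTI; exact: mf.
by move=> x /NM.
Qed.

(** For an arbitrary set, a null preimage does not give a null set for the image measure. A Borel
    image is filled by a Borel set up to a null remainder, and for Borel sets the two notions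
    agree. *)
Lemma pushforward_negligible_image d'' (Z : measurableType d'') (h : Z -> Y) A :
  standard_borel R Z -> standard_borel R Y -> measurable_fun setT h ->
  measurable A ->
  pushforward_prob.-negligible (h @` A) <->
  mu.-negligible (f @^-1` (h @` A)).
Proof.
move=> sZ sY mh mA; split; first exact: pushforward_negligible.
have [B [mB BA AB]] := image_null_measurable pushforward_prob sZ sY mh mA.
move=> fA0; apply: (@negligibleS _ _ _ _ (B `|` (h @` A `\` B))).
  by move=> y hy; have [By|nB] := pselect (B y); [left|right].
have fB0 : mu (f @^-1` B) = 0%E.
  apply: measure_negligible; last by apply: negligibleS fA0 => x /BA.
  by rewrite -[X in measurable X]setTI; exact: mf.
by apply: negligibleU => //; exact/negligibleP.
Qed.

End Pushforward.

Section QuotientGroupoid.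
Context d (T : measurableType d) (R : realType) (G : grpd T)
  (mu : probability T R).
Local Notation U := (gunit G).
Local Notation r := (gr G).
Local Notation s := (gs G).
Local Notation mul := (gmul G).
Local Notation inv := (ginv G).
Local Notation Q := (R * nat)%type.
Hypothesis dG : discrete_measured_groupoid G mu.

Let bG : discrete_borel_groupoid G R. Proof. by case: dG. Qed.
Let ax : groupoid_axioms G. Proof. by case: bG. Qed.
Let sT : standard_borel R T. Proof. by case: bG. Qed.
Let mr : measurable_fun setT r. Proof. by case: bG => _ _ _ []. Qed.
Let ms : measurable_fun setT s. Proof. by case: bG => _ _ _ []. Qed.

Variables (X1 : set T) (pi : T -> R) (q_ : T -> Q) (p : nat -> T -> T).
Variables (idQ rQ sQ iQ : Q -> Q) (cQ : nat -> Q -> Q).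
Hypothesis iX1 : invariant_conull G mu X1.
Hypothesis mpi : measurable_fun setT pi.
Hypothesis mq : measurable_fun setT q_.
Hypothesis mid : measurable_fun setT idQ.
Hypothesis mrQ : measurable_fun setT rQ.
Hypothesis msQ : measurable_fun setT sQ.
Hypothesis miQ : measurable_fun setT iQ.
Hypothesis mcQ : forall n, measurable_fun setT (cQ n).
Hypothesis q1 : forall g, (q_ g).1 = pi (r g).
Hypothesis rp : forall n x, X1 x -> r (p n x) = x.
Hypothesis idE : forall n x, X1 x -> idQ (pi x, n) = q_ (p n x).
Hypothesis id_q : forall g, X1 (r g) -> idQ (q_ g) = q_ g.
Hypothesis rE : forall g, X1 (r g) -> rQ (q_ g) = q_ (r g).
Hypothesis sE : forall g, X1 (r g) -> sQ (q_ g) = q_ (s g).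
Hypothesis spE : forall n x, X1 x -> (sQ (pi x, n)).1 = pi (s (p n x)).
Hypothesis iE : forall g, X1 (r g) -> iQ (q_ g) = q_ (inv g).
Hypothesis cE : forall g h, X1 (r g) -> s g = r h ->
  cQ (q_ h).2 (q_ g) = q_ (mul g h).

Let X1rs g : X1 (r g) <-> X1 (s g). Proof. by case: iX1 => _ _ _; exact. Qed.

(** Starting from the complement of a Borel set inside the image of [X], repeatedly add the base
    points from which some index [n] leads into the part already removed. Each stage stays null: off
    an invariant null set, the arrow [p n x] cannot end in the previous stage. *)
Lemma closed_base X : invariant_conull G mu X -> X `<=` X1 ->
  exists Z, [/\ measurable Z, Z `<=` pi @` X, mu.-negligible (~` (pi @^-1` Z)) &
    forall g, X1 (r g) -> Z (pi (r g)) -> Z (pi (s g))].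
Proof.
move=> [mX _ X0 _] XX1.
have mpi' C : measurable C -> measurable (pi @^-1` C).
  by move=> mC; rewrite -[X in measurable X]setTI; exact: mpi.
have [B [mB BX XB]] := image_null_measurable (pushforward_prob mu mpi) sT
  (standard_borel_real R) mpi mX.
have B0 : mu.-negligible (pi @^-1` (~` B)).
  apply: (@negligibleS _ _ _ _ (~` X `|` pi @^-1` (pi @` X `\` B))).
    move=> x nB; have [Xx|] := pselect (X x); last by left.
    by right; split=> //; exists x.
  apply: negligibleU; last exact: pushforward_negligible XB.
  by apply/negligibleP => //; exact: measurableC.
pose step (W : set R) := W `|` \bigcup_n [set z | W (sQ (z, n)).1].
pose W k := iter k step (~` B).
have mstep n : measurable_fun setT (fun z : R => (sQ (z, n)).1).
  apply: (measurableT_comp measurable_fst); apply: (measurableT_comp msQ).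
  exact: measurable_fun_pair.
have mW k : measurable (W k).
  elim: k => [|k ih]; first exact: measurableC.
  apply: measurableU => //; apply: bigcupT_measurable => n.
  by rewrite -[X in measurable X]setTI; exact: mstep.
have W0 k : mu.-negligible (pi @^-1` W k).
  elim: k => [//|k ih]; have [Y [iY YW]] := invariant_conull_sub dG ih.
  have [_ _ _ Yrs] := iY; have [mYX _ YX0 _] := invariant_conullI iY iX1.
  apply: (@negligibleS _ _ _ _ (pi @^-1` W k `|` ~` (Y `&` X1))); last first.
    by apply: negligibleU => //; apply/negligibleP => //; exact: measurableC.
  move=> x [Wx|[n _ /= Wx]]; [by left|right => -[Yx Xx]].
  move: Wx; rewrite spE//; apply: YW; apply/Yrs; by rewrite rp.
have mU : measurable (\bigcup_k W k) by exact: bigcupT_measurable.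
exists (~` \bigcup_k W k); split.
- exact: measurableC.
- by move=> z nW; apply: BX; apply: contrapT => nB; apply: nW; exists 0%N.
- rewrite -preimage_setC setCK preimage_bigcup; exact: negligible_bigcup.
- move=> g Xg nW [k _ Wk]; apply: nW; exists k.+1 => //=; right.
  exists (q_ g).2 => //=; rewrite -q1 -surjective_pairing sE// q1.
  by rewrite gr_gs.
Qed.

Variable Z0 : set R.
Hypothesis mZ0 : measurable Z0.
Hypothesis Z0_image : Z0 `<=` pi @` X1.
Hypothesis Z0_conull : mu.-negligible (~` (pi @^-1` Z0)).
Hypothesis Z0_closed : forall g, X1 (r g) -> Z0 (pi (r g)) -> Z0 (pi (s g)).

(** On good pairs [idQ] replaces the index [n] by the coset index of [p n x]. Its fixed points over
    [Z0] give a Borel description of the image of the good arrows. *)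
Definition quotient_arrow : set Q := [set q | Z0 q.1 /\ idQ q = q].
Definition lift_base : set T := X1 `&` pi @^-1` Z0.

Lemma invariant_lift_base : invariant_conull G mu lift_base.
Proof.
have [mX1 X1U X10 _] := iX1.
have mpZ : measurable (pi @^-1` Z0).
  by rewrite -[X in measurable X]setTI; exact: mpi.
split; first exact: measurableI.
- by move=> x [/X1U].
- rewrite setCI; apply: measure_negligible.
    by apply: measurableU; exact: measurableC.
  by apply: negligibleU => //; apply/negligibleP => //; exact: measurableC.
- move=> g; split=> -[Xg Zg]; first by split; [exact/X1rs|exact: Z0_closed].
  have := @Z0_closed (inv g); rewrite gr_inv// gs_inv// => h.
  by split; [exact/X1rs|exact: h].
Qed.

Let lift_baseE g : lift_base (r g) <-> lift_base (s g).
Proof. by have [_ _ _] := invariant_lift_base; exact. Qed.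

(** The lift exists over every good unit [x] above the base point, not just over one of them; this
    freedom is what makes composition liftable. *)
Lemma quotient_lift q x : quotient_arrow q -> X1 x -> pi x = q.1 ->
  exists2 g, r g = x & q_ g = q.
Proof.
move=> [_ idq] Xx xq; exists (p q.2 x); first exact: rp.
by rewrite -idE// xq -surjective_pairing.
Qed.

Lemma quotient_arrow_q g : lift_base (r g) -> quotient_arrow (q_ g).
Proof. by move=> [Xg Zg]; split; [rewrite q1|exact: id_q]. Qed.

Lemma quotient_arrow_lift q : quotient_arrow q ->
  exists2 g, lift_base (r g) & q_ g = q.
Proof.
move=> qq; have [x Xx xq] := Z0_image qq.1.
have [g gx gq] := quotient_lift qq Xx xq; exists g => //.
by split; rewrite /= gx// xq; case: qq.
Qed.

Definition on_arrow (F : Q -> Q) q := if `[< quotient_arrow q >] then F q else q.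

Lemma on_arrow_q F g : lift_base (r g) -> on_arrow F (q_ g) = F (q_ g).
Proof. by move=> /quotient_arrow_q qg; rewrite /on_arrow ifT//; exact/asboolP. Qed.

Lemma on_arrow_junk F q : ~ quotient_arrow q -> on_arrow F q = q.
Proof. by move=> nq; rewrite /on_arrow ifF//; apply/negP => /asboolP. Qed.

(* The elements of [R * nat] outside [quotient_arrow] are made into isolated
   units, so that the whole standard Borel space carries the groupoid. *)
Definition quotient_grpd : grpd Q := Grpd
  [set q | quotient_arrow q -> rQ q = q]
  (on_arrow rQ) (on_arrow sQ) (fun q q' => on_arrow (cQ q'.2) q) (on_arrow iQ).

Local Notation GQ := quotient_grpd.

(** Composability only says that [pi (s g)] is the base point of [q], so [q] is lifted afresh over
    [s g]. *)
Lemma quotient_composable_lift g q : lift_base (r g) -> gs GQ (q_ g) = gr GQ q ->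
  exists h, [/\ lift_base (r h), s g = r h & q_ h = q].
Proof.
move=> Lg; rewrite /= on_arrow_q// sE; last by case: Lg.
have Ls : lift_base (r (s g)) by rewrite gr_gs//; exact/lift_baseE.
have [qq|nq] := pselect (quotient_arrow q); last first.
  by rewrite on_arrow_junk// => e; exfalso; apply: nq; rewrite -e;
     exact: quotient_arrow_q.
have [k Lk kq] := quotient_arrow_lift qq.
rewrite -{1}kq on_arrow_q// rE; last by case: Lk.
move=> e; have e1 : pi (s g) = q.1.
  by rewrite -kq q1 -[in RHS](gr_gr ax) -q1 -e q1 gr_gs.
have [|h hs hq] := quotient_lift qq _ e1; first by case: Ls; rewrite gr_gs.
exists h; split=> //; by rewrite hs -(gr_gs ax).
Qed.

Lemma quotient_composable_junk q q' : ~ quotient_arrow q ->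
  gs GQ q = gr GQ q' -> q' = q.
Proof.
move=> nq; rewrite /= on_arrow_junk//.
have [qq|nq'] := pselect (quotient_arrow q'); last by rewrite on_arrow_junk.
have [k Lk <-] := quotient_arrow_lift qq.
rewrite on_arrow_q// rE; last by case: Lk.
move=> e; exfalso; apply: nq; rewrite e; apply: quotient_arrow_q.
by rewrite gr_gr.
Qed.

Lemma quotient_rE g : lift_base (r g) -> gr GQ (q_ g) = q_ (r g).
Proof. by move=> Lg; rewrite /= on_arrow_q// rE//; case: Lg. Qed.

Lemma quotient_sE g : lift_base (r g) -> gs GQ (q_ g) = q_ (s g).
Proof. by move=> Lg; rewrite /= on_arrow_q// sE//; case: Lg. Qed.

Lemma quotient_iE g : lift_base (r g) -> ginv GQ (q_ g) = q_ (inv g).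
Proof. by move=> Lg; rewrite /= on_arrow_q// iE//; case: Lg. Qed.

Lemma quotient_mulE g h : lift_base (r g) -> s g = r h ->
  gmul GQ (q_ g) (q_ h) = q_ (mul g h).
Proof. by move=> Lg gh; rewrite /= on_arrow_q// cE//; case: Lg. Qed.

Lemma quotient_unitE g : lift_base (r g) ->
  gunit GQ (q_ g) <-> q_ (r g) = q_ g.
Proof.
move=> Lg; have := quotient_arrow_q Lg; rewrite /= => qq.
have Xg : X1 (r g) by case: Lg.
by split=> [/(_ qq)|e _]; rewrite rE.
Qed.

Lemma quotient_junk q : ~ quotient_arrow q -> [/\ gunit GQ q, gr GQ q = q,
  gs GQ q = q, ginv GQ q = q & forall q', gmul GQ q q' = q].
Proof. by move=> nq; split; rewrite /= ?on_arrow_junk// => q'; rewrite on_arrow_junk. Qed.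

(** Arrows are lifted one after another along composability, and each law is the image of the same
    law in [G]. Points that are not arrows compose only with themselves. *)
Lemma quotient_groupoid_axioms : groupoid_axioms GQ.
Proof.
have Lr g : lift_base (r g) -> lift_base (r (r g)) by rewrite (gr_gr ax).
have Ls g : lift_base (r g) -> lift_base (r (s g)).
  by rewrite (gr_gs ax) => /lift_baseE.
have Li g : lift_base (r g) -> lift_base (r (inv g)).
  by rewrite (gr_inv ax) => /lift_baseE.
have Lm g h : s g = r h -> lift_base (r g) -> lift_base (r (mul g h)).
  by move=> gh; rewrite (gr_mul ax).
split; [split| | | |].
- move=> q; have [qq|/quotient_junk[? -> -> _ _]//] := pselect (quotient_arrow q).
  have [g Lg <-] := quotient_arrow_lift qq.
  rewrite quotient_rE// quotient_sE//; split; apply/quotient_unitE => //.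
  + exact: Lr.
  + by rewrite (gr_gr ax).
  + exact: Ls.
  + by rewrite (gr_gs ax).
- move=> q; have [qq|/quotient_junk[? -> -> _ _]//] := pselect (quotient_arrow q).
  have [g Lg <-] := quotient_arrow_lift qq.
  move=> /(quotient_unitE Lg) e; split; first by rewrite quotient_rE.
  by rewrite -[in LHS]e quotient_sE ?(gs_gr ax)//; exact: Lr.
- move=> q q'; have [qq|nq] := pselect (quotient_arrow q); last first.
    move=> e; rewrite (quotient_composable_junk nq e).
    by have [_ e1 e2 _ e3] := quotient_junk nq; rewrite e3.
  have [g Lg <-] := quotient_arrow_lift qq.
  move=> /(quotient_composable_lift Lg)[h [Lh gh <-]].
  rewrite quotient_mulE// !quotient_rE ?quotient_sE//; try exact: Lm.
  by rewrite (gr_mul ax)// (gs_mul ax).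
- move=> q q' q''; have [qq|nq] := pselect (quotient_arrow q); last first.
    move=> e; have e' := quotient_composable_junk nq e; rewrite e'.
    by have [_ e1 e2 _ e3] := quotient_junk nq; rewrite !e3.
  have [g Lg <-] := quotient_arrow_lift qq.
  move=> /(quotient_composable_lift Lg)[h [Lh gh <-]].
  move=> /(quotient_composable_lift Lh)[k [Lk hk <-]].
  rewrite (quotient_mulE Lg gh) (quotient_mulE Lh hk).
  rewrite (quotient_mulE (Lm _ _ gh Lg)) ?(gs_mul ax)//.
  by rewrite (quotient_mulE Lg) ?(gr_mul ax)// (gmulA ax).
- move=> q; have [qq|nq] := pselect (quotient_arrow q); last first.
    by have [_ -> -> _ e3] := quotient_junk nq; rewrite e3.
  have [g Lg <-] := quotient_arrow_lift qq.
  rewrite quotient_rE// quotient_sE//.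
  rewrite (quotient_mulE (Lr _ Lg)) ?(gs_gr ax)//.
  by rewrite (quotient_mulE Lg) ?(gr_gs ax)// (gmul_r ax) (gmul_s ax).
- move=> q; have [qq|nq] := pselect (quotient_arrow q); last first.
    by have [_ e1 e2 e3 e4] := quotient_junk nq; rewrite e3 e4 e1 e2.
  have [g Lg <-] := quotient_arrow_lift qq.
  rewrite (quotient_iE Lg) (quotient_rE (Li _ Lg)) (quotient_sE (Li _ Lg)).
  rewrite (quotient_mulE Lg) ?(gr_inv ax)//.
  rewrite (quotient_mulE (Li _ Lg)) ?(gs_inv ax)//.
  by rewrite (quotient_rE Lg) (quotient_sE Lg) (gmulV ax) (gmulVg ax).
Qed.

Lemma measurable_quotient_arrow : measurable quotient_arrow.
Proof.
apply: measurableI.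
  by rewrite -[X in measurable X]setTI; exact: measurable_fst.
apply: standard_borel_measurable_eq => //; exact: standard_borel_real_nat.
Qed.

Lemma measurable_on_arrow F : measurable_fun setT F ->
  measurable_fun setT (on_arrow F).
Proof.
move=> mF; apply: measurable_fun_ifP => //; first exact: measurable_quotient_arrow.
exact: measurable_funTS.
Qed.

Lemma quotient_discrete_borel : discrete_borel_groupoid GQ R.
Proof.
split.
- exact: standard_borel_real_nat.
- exact: quotient_groupoid_axioms.
- rewrite (_ : gunit GQ = ~` quotient_arrow `|` [set q | rQ q = q]).
    apply: measurableU; first by apply: measurableC; exact: measurable_quotient_arrow.
    apply: standard_borel_measurable_eq => //; exact: standard_borel_real_nat.
  apply/seteqP; split=> q /=; last by case=> // ? ?.
  by have [qq h|nq _] := pselect (quotient_arrow q); [right; exact: h|left].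
- by split; exact: measurable_on_arrow.
- split; [|exact: measurable_on_arrow|].
    apply: measurable_funTS.
    apply: (measurable_fun_from_nat (f := fun x : Q * Q => x.2.2)
      (h := fun n x => on_arrow (cQ n) x.1)).
      exact: measurableT_comp measurable_snd measurable_snd.
    move=> n; apply: measurableT_comp measurable_fst.
    exact: measurable_on_arrow.
  (* An arrow with range [x] has base point [x.1], leaving only its index free; a point that is not
     an arrow is its own range. *)
  move=> x _; apply: (@sub_countable _ _ _ ([set x] `|` range (fun n => (x.1, n)))).
    apply: subset_card_le => q /=.
    have [qq|nq] := pselect (quotient_arrow q); last first.
      by rewrite on_arrow_junk// => ->; left.
    have [g Lg <-] := quotient_arrow_lift qq.
    rewrite on_arrow_q// rE => [<-|]; last by case: Lg.
    by right; exists (q_ g).2 => //; rewrite q1 (gr_gr ax) -q1 -surjective_pairing.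
  rewrite -bigcup2E; apply: bigcup_countable => // -[|[|n]] _ /=;
    [exact: countable1|exact: card_image_le|exact: countable0].
Qed.

Lemma lift_base_nonempty : lift_base !=set0.
Proof. by have [m _ m0 _] := invariant_lift_base; exact: conull_nonempty m m0. Qed.

Variable x0 : T.
Hypothesis x0_lift : lift_base x0.

(** Bad arrows all go to the unit [q_ x0]. As the good base is invariant, no bad arrow composes with
    a good one, so the homomorphism laws hold everywhere. *)
Definition quotient_hom g := if `[< lift_base (r g) >] then q_ g else q_ x0.

Let rx0 : r x0 = x0.
Proof.
by apply: (gr_unit ax); have [_ LU _ _] := invariant_lift_base; exact: LU.
Qed.
Let sx0 : s x0 = x0.
Proof.
by apply: (gs_unit ax); have [_ LU _ _] := invariant_lift_base; exact: LU.
Qed.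
Let Lx0 : lift_base (r x0). Proof. by rewrite rx0. Qed.
Let mL : measurable lift_base. Proof. by case: invariant_lift_base. Qed.

Lemma quotient_homE g : lift_base (r g) -> quotient_hom g = q_ g.
Proof. by move=> Lg; rewrite /quotient_hom ifT//; exact/asboolP. Qed.

Lemma quotient_hom_junk g : ~ lift_base (r g) -> quotient_hom g = q_ x0.
Proof. by move=> Lg; rewrite /quotient_hom ifF//; apply/negP => /asboolP. Qed.

Lemma measurable_quotient_hom : measurable_fun setT quotient_hom.
Proof.
apply: (@measurable_fun_ifP _ _ _ _ (r @^-1` lift_base)) => //.
  by rewrite -[X in measurable X]setTI; exact: mr.
exact: measurable_funTS.
Qed.

Lemma borel_hom_quotient : borel_hom G GQ quotient_hom.
Proof.
have ux0 : gunit GQ (q_ x0) by apply/quotient_unitE; rewrite ?rx0.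
split.
- exact: measurable_quotient_hom.
- move=> u Uu; have [Lu|/quotient_hom_junk ->//] := pselect (lift_base (r u)).
  by rewrite quotient_homE//; apply/quotient_unitE => //; rewrite (gr_unit ax Uu).
- move=> g; have [Lg|nLg] := pselect (lift_base (r g)).
    rewrite !quotient_homE ?quotient_rE ?quotient_sE ?(gr_gr ax) ?(gr_gs ax)//.
    exact/lift_baseE.
  rewrite !quotient_hom_junk ?(gr_gr ax) ?(gr_gs ax)//; last by move=> /lift_baseE.
  by rewrite quotient_rE// quotient_sE// rx0 sx0.
- move=> g h gh; have [Lg|nLg] := pselect (lift_base (r g)).
    have Lh : lift_base (r h) by rewrite -gh; exact/lift_baseE.
    by rewrite !quotient_homE ?(gr_mul ax)// quotient_mulE.
  have nLh : ~ lift_base (r h) by rewrite -gh => /lift_baseE.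
  rewrite !quotient_hom_junk ?(gr_mul ax)//.
  have c : s x0 = r x0 by rewrite rx0.
  by rewrite (quotient_mulE Lx0 c) -{2}rx0 (gmul_r ax).
Qed.

Local Notation zeta := (pushforward_prob mu measurable_quotient_hom).

Let r_lift x : lift_base x -> r x = x.
Proof.
by move=> Lx; apply: (gr_unit ax); have [_ LU _ _] := invariant_lift_base; exact: LU.
Qed.
Let s_lift x : lift_base x -> s x = x.
Proof.
by move=> Lx; apply: (gs_unit ax); have [_ LU _ _] := invariant_lift_base; exact: LU.
Qed.

Lemma quotient_hom_surj x q : lift_base x -> gr GQ q = quotient_hom x ->
  exists2 g, r g = x & quotient_hom g = q.
Proof.
move=> Lx; have Lrx : lift_base (r x) by rewrite r_lift.
rewrite quotient_homE// => e.
have [|g [Lg gx gq]] := @quotient_composable_lift x q Lrx.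
  by rewrite e quotient_sE// s_lift.
by exists g; rewrite ?quotient_homE// -gx s_lift.
Qed.

Lemma quotient_hom_surj_s x q : lift_base x -> gs GQ q = quotient_hom x ->
  exists2 g, s g = x & quotient_hom g = q.
Proof.
move=> Lx sq; have aq := quotient_groupoid_axioms.
have [|g gx gq] := @quotient_hom_surj x (ginv GQ q) Lx.
  by rewrite (gr_inv aq).
have Lg : lift_base (r g) by rewrite gx.
exists (inv g); first by rewrite (gs_inv ax).
rewrite quotient_homE ?(gr_inv ax); last exact/lift_baseE.
by rewrite -quotient_iE// -(quotient_homE Lg) gq (ginvK aq).
Qed.

Lemma lift_base_conull : mu.-negligible (~` lift_base).
Proof.
have [m _ m0 _] := invariant_lift_base.
by apply/negligibleP => //; exact: measurableC.
Qed.

Lemma negligible_mod_lift (A B : set T) :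
  (forall x, lift_base x -> A x <-> B x) ->
  mu.-negligible A <-> mu.-negligible B.
Proof.
move=> AB; split=> /(fun h => negligibleU h lift_base_conull);
  apply: negligibleS => x; have [Lx|nLx] := pselect (lift_base x).
- by move=> /(AB _ Lx); left.
- by right.
- by move=> /(AB _ Lx); left.
- by right.
Qed.

(** Over good units, surjectivity on range and source fibres identifies the preimage of the range
    (or source) image of [A] with the range (or source) image of the preimage of [A].
    Quasi-invariance of [mu] then transfers. *)
Lemma quotient_discrete_measured : discrete_measured_groupoid GQ zeta.
Proof.
have bQ := quotient_discrete_borel; have [sQ' _ mU [mrq msq] _] := bQ.
have [_ muU qi] := dG; have [_ homU homrs _] := borel_hom_quotient.
have mh := measurable_quotient_hom.
have mh' A : measurable A -> measurable (quotient_hom @^-1` A).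
  by move=> mA; rewrite -[X in measurable X]setTI; exact: mh.
split=> //.
  have [_ _ mUG _ _] := bG.
  suff : mu.-negligible (quotient_hom @^-1` (~` gunit GQ)).
    by move=> /(measure_negligible (mh' _ (measurableC mU))).
  apply: (@negligibleS _ _ _ _ (~` U)).
    by move=> x nx Ux; apply: nx; exact: homU.
  by apply/negligibleP => //; exact: measurableC.
move=> A mA; have mhA := mh' A mA.
have hr : mu.-negligible (quotient_hom @^-1` (gr GQ @` A)) <->
    mu.-negligible (r @` (quotient_hom @^-1` A)).
  apply: negligible_mod_lift => x Lx; split=> [[q Aq /= qx]|[g Ag <-]].
    by have [g gx gq] := quotient_hom_surj Lx qx; exists g; rewrite //= gq.
  by exists (quotient_hom g) => //; have [-> _] := homrs g.
have hs : mu.-negligible (quotient_hom @^-1` (gs GQ @` A)) <->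
    mu.-negligible (s @` (quotient_hom @^-1` A)).
  apply: negligible_mod_lift => x Lx; split=> [[q Aq /= qx]|[g Ag <-]].
    by have [g gx gq] := quotient_hom_surj_s Lx qx; exists g; rewrite //= gq.
  by exists (quotient_hom g) => //; have [_ ->] := homrs g.
have pr := pushforward_negligible_image mu mh sQ' sQ' mrq mA.
have ps := pushforward_negligible_image mu mh sQ' sQ' msq mA.
split.
  move=> /(mu_r_eq0 zeta bQ mA)/pr/hr/(mu_r_eq0 mu bG mhA)/(qi _ mhA).
  by move=> /(mu_s_eq0 mu bG mhA)/hs/ps/(mu_s_eq0 zeta bQ mA).
move=> /(mu_s_eq0 zeta bQ mA)/ps/hs/(mu_s_eq0 mu bG mhA)/(qi _ mhA).
by move=> /(mu_r_eq0 mu bG mhA)/hr/pr/(mu_r_eq0 zeta bQ mA).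
Qed.

Lemma quotient_kernel (S : set T) :
  (forall g, X1 (r g) -> q_ (r g) = q_ g <-> S g) ->
  Gnull G mu ((ker GQ quotient_hom `\` S) `|` (S `\` ker GQ quotient_hom)).
Proof.
move=> qS; apply/(GnullP mu bG); apply: negligibleS lift_base_conull.
move=> _ [g h <-] Lg; have [Xg _] := Lg; move: h.
have kE : ker GQ quotient_hom g <-> S g.
  by rewrite /ker /mkset quotient_homE// quotient_unitE// qS.
by move=> [[/kE]|[/kE]].
Qed.

Section Universal.
Context dQ' (TQ' : measurableType dQ') (Q' : grpd TQ') (f : T -> TQ').
Variables (X : set T) (F : Q -> TQ').
Hypothesis bQ' : discrete_borel_groupoid Q' R.
Hypothesis homf : borel_hom G Q' f.
Hypothesis iX : invariant_conull G mu X.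
Hypothesis XL : X `<=` lift_base.
Hypothesis mF : measurable_fun setT F.
Hypothesis fF : forall g, X (r g) -> f g = F (q_ g).

Let XX1 : X `<=` X1. Proof. by move=> x /XL[]. Qed.

(** [F] is controlled only over base points lifting to [X], so [tau] equals [F] over a closed conull
    Borel set [Z] of these and the constant unit [u0] elsewhere. *)
Lemma quotient_universal : exists tau : Q -> TQ',
  borel_hom GQ Q' tau /\ Gnull G mu [set g | f g <> tau (quotient_hom g)].
Proof.
have [mf fU frs fM] := homf; have [_ axQ _ _ _] := bQ'.
have [Z [mZ ZX Z1 Zcl]] := closed_base iX XX1.
have [mX XU X10 Xrs] := iX.
pose u0 := f x0; have Uu0 : gunit Q' u0.
  by apply: fU; have [_ LU _ _] := invariant_lift_base; exact: LU.
pose D : set Q := quotient_arrow `&` fst @^-1` Z.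
have mD : measurable D.
  apply: measurableI; first exact: measurable_quotient_arrow.
  by rewrite -[X in measurable X]setTI; exact: measurable_fst.
pose tau q := if `[< D q >] then F q else u0.
have tauD q : ~ D q -> tau q = u0.
  by move=> nD; rewrite /tau ifF//; apply/negP => /asboolP.
have Zs g : X1 (r g) -> Z (pi (r g)) <-> Z (pi (s g)).
  move=> Xg; split; first exact: Zcl.
  have := Zcl (inv g); rewrite (gr_inv ax) (gs_inv ax) => h.
  by apply: h; exact/X1rs.
have liftD q : D q -> exists g, [/\ X (r g), Z (pi (r g)) & q_ g = q].
  move=> [qq Zq]; have [x Xx xq] := ZX _ Zq.
  have [g gx gq] := quotient_lift qq (XX1 Xx) xq.
  by exists g; rewrite gx; split=> //; rewrite xq.
have tauE g : X (r g) -> Z (pi (r g)) -> tau (q_ g) = f g.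
  move=> Xg Zg; rewrite fF// /tau ifT//; apply/asboolP; split; last by rewrite /= q1.
  by apply: quotient_arrow_q; exact: XL.
have XZs g : X (r g) -> Z (pi (r g)) ->
    [/\ lift_base (r g), X1 (r g), X (s g) & Z (pi (s g))].
  move=> Xg Zg; split; [exact: XL|exact: XX1|exact/Xrs|].
  by apply: Zcl => //; exact: XX1.
(* No arrow joins a base point of [D] to one outside, so the constant extension respects range,
   source and products. *)
have junk q : ~ D q -> ~ D (gr GQ q) /\ ~ D (gs GQ q).
  move=> nD; have [qq|nq] := pselect (quotient_arrow q); last first.
    by have [_ -> -> _ _] := quotient_junk nq.
  have [g Lg gq] := quotient_arrow_lift qq; have [Xg _] := Lg.
  have nZ : ~ Z (pi (r g)) by move=> Zg; apply: nD; split=> //; rewrite /= -gq q1.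
  rewrite -gq quotient_rE// quotient_sE//; split=> -[_] /=; rewrite q1.
    by rewrite (gr_gr ax).
  by rewrite (gr_gs ax) => /(Zs _ Xg).
exists tau; split.
  split.
  - by apply: measurable_fun_ifP => //; exact: measurable_funTS.
  - move=> q Uq; have [/liftD[g [Xg Zg gq]]|/tauD ->//] := pselect (D q).
    have [Lg _ _ _] := XZs g Xg Zg.
    move: Uq; rewrite -gq => /(quotient_unitE Lg) <-.
    rewrite tauE ?(gr_gr ax)//; apply: fU; exact: (gunit_r ax).
  - move=> q; have [/liftD[g [Xg Zg <-]]|nD] := pselect (D q).
      have [Lg X1g Xs Zsg] := XZs g Xg Zg; have [f1 f2] := frs g.
      rewrite quotient_rE// quotient_sE// !tauE ?(gr_gr ax) ?(gr_gs ax)//.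
    have [n1 n2] := junk q nD.
    by rewrite !tauD// (gr_unit axQ)// (gs_unit axQ).
  - move=> q q' e; have [/liftD[g [Xg Zg gq]]|nD] := pselect (D q).
      have [Lg X1g Xs Zsg] := XZs g Xg Zg; move: e; rewrite -gq => e.
      have [h [Lh gh <-]] := quotient_composable_lift Lg e.
      rewrite (quotient_mulE Lg gh) !tauE ?fM ?(gr_mul ax)//; by rewrite -gh.
    have nD' : ~ D q'.
      have [_ n2] := junk q nD; move: n2; rewrite e => n2.
      move=> /liftD[h [Xh Zh hq]]; apply: n2; rewrite -hq.
      have [Lh _ _ _] := XZs h Xh Zh; rewrite quotient_rE//.
      split; last by rewrite /= q1 (gr_gr ax).
      by apply: quotient_arrow_q; rewrite (gr_gr ax).
    rewrite !tauD//.
      have u0r : gr Q' u0 = u0 := gr_unit axQ Uu0.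
      by rewrite -{2}u0r (gmul_r axQ).
    move=> Dm.
    have aq := quotient_groupoid_axioms.
    have rm : gr GQ (gmul GQ q q') = gr GQ q by exact: (gr_mul aq e).
    have [n1 _] := junk q nD; apply: n1; rewrite -rm.
    have [k [Xk Zk <-]] := liftD _ Dm.
    have [Lk _ _ _] := XZs k Xk Zk; rewrite quotient_rE//.
    split; last by rewrite /= q1 (gr_gr ax).
    by apply: quotient_arrow_q; rewrite (gr_gr ax).
apply/(GnullP mu bG).
have X0 : mu.-negligible (~` X) by apply/negligibleP => //; exact: measurableC.
apply: negligibleS (negligibleU X0 Z1) => _ [g fg <-].
have [Xg|] := pselect (X (r g)); [right => Zg|by left].
by apply: fg; rewrite quotient_homE ?tauE//; exact: XL.
Qed.

End Universal.

End QuotientGroupoid.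

(** * Assembly of the structure maps, and the theorem *)

Section StructureMaps.
Context d (T : measurableType d) (R : realType) (G : grpd T)
  (mu : probability T R) (S : set T).
Hypothesis dG : discrete_measured_groupoid G mu.
Hypothesis nS : normal_subgroupoid G mu S.
Local Notation r := (gr G).
Local Notation s := (gs G).
Local Notation mul := (gmul G).
Local Notation inv := (ginv G).

(** Each factorization comes with its own invariant conull set. There are countably many, one for
    each multiplication by [p n] and four more, so a single [X1] makes all the equations exact.
    Factoring [q_] itself produces [idQ]. *)
Lemma quotient_structure_maps : exists (X1 : set T) (p : nat -> T -> T)
    (pi : T -> R) (idQ rQ sQ iQ : R * nat -> R * nat)
    (cQ : nat -> R * nat -> R * nat),
  let q_ := quotient_map G S p pi in
  [/\ [/\ invariant_conull G mu X1, measurable_fun setT pi,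
          measurable_fun setT q_ & forall n x, X1 x -> r (p n x) = x],
      [/\ measurable_fun setT idQ, measurable_fun setT rQ,
          measurable_fun setT sQ, measurable_fun setT iQ &
          forall n, measurable_fun setT (cQ n)],
      [/\ forall n x, X1 x -> idQ (pi x, n) = q_ (p n x),
          forall g, X1 (r g) -> idQ (q_ g) = q_ g &
          forall n x, X1 x -> (sQ (pi x, n)).1 = pi (s (p n x))],
      [/\ forall g, X1 (r g) -> rQ (q_ g) = q_ (r g),
          forall g, X1 (r g) -> sQ (q_ g) = q_ (s g),
          forall g, X1 (r g) -> iQ (q_ g) = q_ (inv g) &
          forall g h, X1 (r g) -> s g = r h ->
            cQ (q_ h).2 (q_ g) = q_ (mul g h)] &
      [/\ forall g, X1 (r g) -> q_ (r g) = q_ g <-> S g &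
          forall d' (Z : measurableType d') (f : T -> Z) X,
            invariant_conull G mu X -> X `<=` X1 -> standard_borel R Z ->
            measurable_fun setT f -> congruence_invariant G S X f ->
            exists (F : R * nat -> Z) (Y : set T),
            [/\ measurable_fun setT F, invariant_conull G mu Y, Y `<=` X &
                forall g, Y (r g) -> f g = F (q_ g)]]].
Proof.
have [bG _ _] := dG; have [subS _] := nS; have [sT ax _ [mr ms] [_ mi _]] := bG.
have [X0 [p [iX0 mp rp pS pN]]] := normal_subgroupoid_choice dG nS.
have [pi [pi_inv pi_fac]] := sub_sigma_algebra_factor mu sT
  (sigma_algebra_invariant G S X0) (fun A => @proj1 _ _).
have mpi := measurable_pi pi_inv.
have mq := measurable_quotient_map dG subS mp pi_inv.
have qinv := quotient_map_invariant dG subS iX0 rp pN pi_inv.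
have fac := @congruence_factor _ _ _ _ _ _ dG subS _ _ iX0 mp rp pS pN _ pi_fac.
have facQ f := fac X0 _ _ f iX0 (fun x => id) (standard_borel_real_nat R).
have [idQ [Y1 [mid iY1 _ id1 id2]]] := facQ _ mq qinv.
have [rQ [Y2 [mrQ iY2 _ r1 _]]] := facQ _ (measurableT_comp mq mr)
  (congruence_invariant_r dG subS iX0 rp pN pi_inv).
have [sQ [Y3 [msQ iY3 _ s1 s2]]] := facQ _ (measurableT_comp mq ms)
  (congruence_invariant_s dG subS iX0 rp pN pi_inv).
have [iQ [Y4 [miQ iY4 _ i1 _]]] := facQ _ (measurableT_comp mq mi)
  (congruence_invariant_inv dG subS iX0 rp pN pi_inv).
have mqp n : measurable_fun setT
    (fun g => quotient_map G S p pi (total_gmul G g (p n (s g)))).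
  apply: (measurableT_comp mq); apply: (measurable_total_gmul bG) => //.
  exact: measurableT_comp (mp n) ms.
have /choice[cY HcY] n : exists cY : (R * nat -> R * nat) * set T,
    [/\ measurable_fun setT cY.1, invariant_conull G mu cY.2 &
      forall g, cY.2 (r g) -> quotient_map G S p pi (total_gmul G g (p n (s g))) =
        cY.1 (quotient_map G S p pi g)].
  have [c [Y [? ? _ ? _]]] := facQ _ (mqp n)
    (congruence_invariant_mulp dG subS iX0 rp pN pi_inv n).
  by exists (c, Y).
have cY0 n : mu.-negligible (~` (cY n).2).
  have [_ [mY _ Y0 _] _] := HcY n; apply/negligibleP => //; exact: measurableC.
have [Y5 [iY5 Y5c]] := invariant_conull_sub dG (negligible_bigcup cY0).
have iX1 := invariant_conullI iX0 (invariant_conullI (invariant_conullI iY1 iY2)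
  (invariant_conullI (invariant_conullI iY3 iY4) iY5)).
pose X1 := X0 `&` (Y1 `&` Y2 `&` (Y3 `&` Y4 `&` Y5)).
exists X1, p, pi, idQ, rQ, sQ, iQ, (fun n => (cY n).1) => q_.
have r_s x : r (s x) = s x by rewrite gr_gs.
split; split=> //.
- by move=> n x [Xx _]; exact: rp.
- by move=> n; have [] := HcY n.
- by move=> n x [_ [[Yx _] _]]; rewrite -id2.
- by move=> g [_ [[Yx _] _]]; rewrite -id1.
- by move=> n x [_ [_ [[Yx _] _]]]; rewrite -s2//= r_s.
- by move=> g [_ [[_ Yx] _]]; rewrite -r1.
- by move=> g [_ [_ [[Yx _] _]]]; rewrite -s1.
- by move=> g [_ [_ [[_ Yx] _]]]; rewrite -i1.
- move=> g h [Xg [_ [_ Yg]]] gh.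
  rewrite [RHS](quotient_map_mul dG subS iX0 rp pS pN)//.
  have [_ _ <-//] := HcY (q_ h).2.
  by apply: contrapT => nY; apply: (Y5c _ Yg); exists (q_ h).2.
- by move=> g [Xg _]; exact: (quotient_map_kernel dG subS iX0 rp pS pN pi_inv).
move=> d' Z f X iX XX1 sZ mf fX.
have XX0 : X `<=` X0 by move=> x /XX1[].
by have [F [Y [? ? ? ? _]]] := fac X d' Z f iX XX0 sZ mf fX; exists F, Y.
Qed.

End StructureMaps.

Section KernelInvariance.
Context d (T : measurableType d) (R : realType) (G : grpd T)
  (mu : probability T R) (S : set T).
Context d' (T' : measurableType d') (Q' : grpd T') (f : T -> T').
Hypothesis axG : groupoid_axioms G.
Hypothesis axQ' : groupoid_axioms Q'.
Hypothesis homf : borel_hom G Q' f.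

Lemma congruence_invariant_ker (X : set T) : invariant_conull G mu X ->
  (forall g, S g -> X (gr G g) -> ker Q' f g) -> congruence_invariant G S X f.
Proof.
move=> [_ _ _ Xrs] Sker a g b Sa Sb ag gb Xg; have [_ _ frs fM] := homf.
have Xa : X (gr G a) by apply/Xrs; rewrite ag.
have Xb : X (gr G b) by rewrite -gb; exact/Xrs.
have ua := Sker a Sa Xa; have ub := Sker b Sb Xb.
have agb : gs G (gmul G a g) = gr G b by rewrite (gs_mul axG).
have [ra sa] := frs a; have [rb sb] := frs b; have [rg sg] := frs g.
have fa : f a = gr Q' (f g) by rewrite rg -ag -sa (gs_unit axQ').
have fb : f b = gs Q' (f g) by rewrite sg gb -rb (gr_unit axQ').
by rewrite (fM _ _ agb) (fM _ _ ag) fa fb (gmul_r axQ') (gmul_s axQ').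
Qed.

End KernelInvariance.

Theorem theorem2p4 (R : realType) (d : measure_display) (T : measurableType d)
  (G : grpd T) (mu : probability T R) (S : set T) :
  discrete_measured_groupoid G mu ->
  normal_subgroupoid G mu S ->
  exists (dQ : measure_display) (TQ : measurableType dQ) (Q : grpd TQ)
         (zeta : probability TQ R) (theta : T -> TQ),
    [/\ discrete_measured_groupoid Q zeta /\ borel_hom G Q theta,
        (forall B, measurable B -> zeta B = mu (theta @^-1` B)),
        (* (1) ker theta = S up to null sets *)
        Gnull G mu ((ker Q theta `\` S) `|` (S `\` ker Q theta)),
        (* (2) class-surjectivity *)
        {ae mu, forall x, gunit G x -> forall q, gr Q q = theta x ->
            exists g, gr G g = x /\ theta g = q} &
        (* (3) universal property *)
        (forall (dQ' : measure_display) (TQ' : measurableType dQ')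
                (Q' : grpd TQ') (theta' : T -> TQ'),
            discrete_borel_groupoid Q' R ->
            borel_hom G Q' theta' ->
            Gnull G mu (S `\` ker Q' theta') ->
            exists tau : TQ -> TQ',
              borel_hom Q Q' tau /\
              Gnull G mu [set g | theta' g <> tau (theta g)])].
Proof.
move=> dG nS; have [bG _ _] := dG; have [sT ax _ _ _] := bG.
have [X1 [p [pi [idQ [rQ [sQ [iQ [cQ]]]]]]]] := quotient_structure_maps dG nS.
set q_ := quotient_map G S p pi => /= -[].
move=> [iX1 mpi mq rp] [mid mrQ msQ miQ mcQ] [idE id_q spE] [rE sE iE cE].
move=> [qS fac].
have q1 g : (q_ g).1 = pi (gr G g) by [].
have [Z0 [mZ0 Z0X Z01 Z0cl]] :=
  closed_base dG iX1 mpi msQ q1 rp sE spE iX1 (fun x => id).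
have [x0 Lx0] := lift_base_nonempty dG iX1 mpi mZ0 Z01 Z0cl.
have mth := measurable_quotient_hom dG iX1 mpi mq mZ0 Z01 Z0cl x0.
exists _, (R * nat)%type, (quotient_grpd idQ rQ sQ iQ cQ Z0),
  (pushforward_prob mu mth), (quotient_hom G X1 pi q_ Z0 x0).
have iL := invariant_lift_base dG iX1 mpi mZ0 Z01 Z0cl.
split.
- split.
    have := quotient_discrete_measured dG iX1 mpi mq mid mrQ msQ miQ mcQ q1 rp
      idE id_q rE sE iE cE mZ0 Z0X Z01 Z0cl Lx0.
    by rewrite (Prop_irrelevance mth
      (measurable_quotient_hom dG iX1 mpi mq mZ0 Z01 Z0cl x0)).
  exact: (borel_hom_quotient dG iQ iX1 mpi mq q1 id_q rE sE cE mZ0 Z01 Z0cl Lx0).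
- by move=> B _; exact: pushforward_probE.
- exact: (quotient_kernel dG sQ iQ cQ iX1 mpi q1 id_q rE mZ0 Z01 Z0cl x0 qS).
- apply: negligibleS (lift_base_conull dG iX1 mpi mZ0 Z01 Z0cl) => x nx Lx.
  apply: nx => _ q qx.
  have [g gx gq] := quotient_hom_surj dG iX1 mpi q1 rp idE id_q rE sE
    mZ0 Z0X Z01 Z0cl Lx qx.
  by exists g.
- move=> dQ' TQ' Q' f bQ' homf /(GnullP mu bG) N0.
  have [sQ' axQ' _ _ _] := bQ'; have [mf _ _ _] := homf.
  (* Over [X2] the inclusion of [S] in the kernel of [f] has no exceptions, so [f] is exactly
     constant on double cosets of [S] there. *)
  have [X2 [iX2 X2N]] := invariant_conull_sub dG N0.
  have iX := invariant_conullI iL iX2.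
  have XX1 : lift_base X1 pi Z0 `&` X2 `<=` X1 by move=> x [[]].
  have fX : congruence_invariant G S (lift_base X1 pi Z0 `&` X2) f.
    apply: (congruence_invariant_ker ax axQ' homf iX) => g Sg [_ Xg].
    by apply: contrapT => nk; apply: (X2N _ Xg); exists g.
  have [F [Y [mF iY YX fF]]] := fac _ _ _ _ iX XX1 sQ' mf fX.
  have YL : Y `<=` lift_base X1 pi Z0 by move=> x /YX[].
  exact: (quotient_universal dG iX1 mpi mid msQ q1 rp idE id_q rE sE spE iE cE
    mZ0 Z0X Z01 Z0cl Lx0 bQ' homf iY YL mF fF).
Qed.
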